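(* Let $n\in\mathbb{Z}$, $n\neq0$. Each component of the $\mathrm{SL}_2\mathbb{C}$-character variety of the odd-twisted Whitehead link $W_{2n-1}$ is a smooth surface in $\mathbb{C}^3$.
   Context: For $k\in\mathbb{Z}$, $W_k$ is the $k$-twisted Whitehead link in $S^3$, a two-component link whose standard diagram has a region of $k$ half twists; $W_1$ is the Whitehead link. For $k=2n-1$ the link group is $\pi_1(S^3-W_{2n-1})=\langle m,\mu\mid m\omega=\omega m\rangle$ with $\omega=(\mu m\mu^{-1}m^{-1})^n\,m\,(m^{-1}\mu^{-1}m\mu)^n$, where $m,\mu$ are meridians of the two components. The $\mathrm{SL}_2\mathbb{C}$-character variety $X(S^3-W_{2n-1})$ is the algebraic set of characters $\mathrm{Tr}\,\rho$ of all representations $\rho:\pi_1(S^3-W_{2n-1})\to\mathrm{SL}_2\mathbb{C}$. It is regarded as a subset of $\mathbb{C}^3$ via the coordinates $x=\mathrm{Tr}\,m$, $y=\mathrm{Tr}\,\mu$, $z=\mathrm{Tr}\,m\mu$. Put $v=\mathrm{Tr}(\mu m\mu^{-1}m^{-1})=x^2+y^2+z^2-xyz-2$. Let $S_k(v)\in\mathbb{Z}[v]$ ($k\in\mathbb{Z}$) be defined by $S_0=1$, $S_1=v$, $S_{k+2}=vS_{k+1}-S_k$, and put $f_n=xy\,S_{n-1}(v)-(xy-z)S_{n-2}(v)-z\,S_n(v)$. Then $X(S^3-W_{2n-1})=\{(v-2)\,f_n\,S_{n-1}(v)=0\}\subset\mathbb{C}^3$. Here the factor $v-2$ corresponds to the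 reducible characters, the factor $f_n$ to the geometric component (the one containing the class of holonomy representations), and the factor $S_{n-1}(v)$ to the $|n|-1$ further components $v=2\cos\frac{j\pi}{n}$, $0<j<|n|$.
   Formalization: The component of reducible characters, v=2, is singular at the four characters of central representations, e.g. (2,2,2); it is shown to be a surface smooth exactly off these points, while every other component is shown to be a smooth surface. *)

(* Defs.v *)
From HB Require Import structures.
From mathcomp Require Import all_boot all_order all_algebra.
From mathcomp Require Import boolp classical_sets reals complex.
From mathcomp Require Import mpoly.

Set Implicit Arguments.
Unset Strict Implicit.
Unset Printing Implicit Defensive.

Import Order.TTheory GRing.Theory Num.Theory.
Local Open Scope ring_scope.
Local Open Scope classical_set_scope.

Section AffineSpace3.
Variable K : fieldType.
Implicit Types (Z X A B : set 'rV[K]_3) (p w : 'rV[K]_3) (q : {mpoly K[3]}).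

Definition peval q p : K := q.@[fun i => p 0 i].

Definition zero_locus (F : set {mpoly K[3]}) : set 'rV[K]_3 :=
  [set p | forall q, F q -> peval q p = 0].

Definition vanishing_ideal Z : set {mpoly K[3]} :=
  [set q | forall p, Z p -> peval q p = 0].

Definition zariski_closed Z := exists F, Z = zero_locus F.

Definition zariski_irreducible Z :=
  Z !=set0 /\
  forall A B, zariski_closed A -> zariski_closed B ->
    Z `<=` A `|` B -> Z `<=` A \/ Z `<=` B.

Definition irreducible_component X Z :=
  [/\ zariski_closed Z, zariski_irreducible Z, Z `<=` X &
      forall A, zariski_closed A -> zariski_irreducible A ->
        Z `<=` A -> A `<=` X -> A = Z].

(* The classes of a_0, ..., a_(d-1) in the coordinate ring K[x,y,z]/I(Z) are
   algebraically independent over K. *)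
Definition alg_independent_on Z (d : nat) (a : d.-tuple {mpoly K[3]}) :=
  forall P : {mpoly K[d]}, vanishing_ideal Z (P \mPo a) -> P = 0.

(* For Z irreducible: dim Z is the transcendence degree over K of the
   coordinate ring (equivalently, of the function field) of Z. *)
Definition has_dimension Z (d : nat) :=
  (exists a : d.-tuple {mpoly K[3]}, alg_independent_on Z a) /\
  ~ (exists a : d.+1.-tuple {mpoly K[3]}, alg_independent_on Z a).

(* Zariski tangent space: the common kernel of the differentials at p of all
   the polynomials vanishing on Z. *)
Definition tangent_space Z p : set 'rV[K]_3 :=
  [set w | forall q, vanishing_ideal Z q ->
             \sum_(i < 3) peval q^`M(i) p * w 0 i = 0].

Definition tangent_dimension Z p (d : nat) :=
  exists2 W : 'M[K]_3, \rank W = d & forall w, tangent_space Z p w <-> (w <= W)%MS.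

Definition smooth_at Z p :=
  exists2 d, has_dimension Z d & tangent_dimension Z p d.

Definition surface Z :=
  [/\ zariski_closed Z, zariski_irreducible Z & has_dimension Z 2].

Definition smooth_surface Z := surface Z /\ forall p, Z p -> smooth_at Z p.

End AffineSpace3.

Section TwistedWhiteheadLink.
Variable R : realType.
Local Notation C := (R[i]).
Implicit Types (n : int) (M U : 'M[C]_2).

(* The word (mu m mu^-1 m^-1)^n m (m^-1 mu^-1 m mu)^n evaluated at m = M and
   mu = U. *)
Definition omega n M U : 'M[C]_2 :=
  (U * M * U^-1 * M^-1) ^ n * M * (M^-1 * U^-1 * M * U) ^ n.

(* A homomorphism from < m, mu | m omega = omega m >, the group of the link
   W_(2n-1), to SL_2(C), given by the images M of m and U of mu. *)
Definition representation n M U :=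
  [/\ \det M = 1, \det U = 1 & M * omega n M U = omega n M U * M].

(* The character of the representation in the coordinates x = Tr m, y = Tr mu,
   z = Tr (m mu), which determine it by the Fricke-Vogt theorem. *)
Definition char_point M U : 'rV[C]_3 :=
  \row_(i < 3) [:: \tr M; \tr U; \tr (M * U)]`_i.

Definition character_variety n : set 'rV[C]_3 :=
  [set p | exists M U, representation n M U /\ p = char_point M U].

Definition reducible_rep M U :=
  exists v : 'rV[C]_2, [/\ v != 0, stablemx v M & stablemx v U].

Definition reducible_characters n : set 'rV[C]_3 :=
  [set p | exists M U, [/\ representation n M U, reducible_rep M U &
                           p = char_point M U]].

Definition central_characters n : set 'rV[C]_3 :=
  [set p | exists M U, [/\ representation n M U, is_scalar_mx M, is_scalar_mx U &
                           p = char_point M U]].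

End TwistedWhiteheadLink.

(* Main.v *)
Require Import Defs.
From HB Require Import structures.
From mathcomp Require Import all_boot all_order all_algebra.
From mathcomp Require Import boolp classical_sets reals complex.
From mathcomp Require Import mpoly.
From mathcomp Require Import zify ring.

Set Implicit Arguments.
Unset Strict Implicit.
Unset Printing Implicit Defensive.

Import Order.TTheory GRing.Theory Num.Theory.
Local Open Scope ring_scope.
Local Open Scope classical_set_scope.

(** Let [x], [y], [z] be the traces of [m], [mu], [m mu], and [v] the trace of
    the commutator of [mu] and [m].  In [SL_2] one has [A^n = a(v) A - b(v)] when
    [tr A = v], where [a = S_(n-1)] and [b = S_(n-2)] are Chebyshev polynomials,
    so that the word [w] of the relation is a combination of [1], [m] and [mu];
    its coefficient at [mu] is [a(v) f], where
    [f = x y (a - b)(v) - z (v a(v) - 2 b(v))].  Since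
    [m w - w m = a(v) f (m mu - mu m)] ([link_relation_commutator]), and since
    commuting matrices have [v = 2], the character variety is the surface
    [(v - 2) a(v) f = 0] ([character_varietyE]).

    A component [Z] thus lies on [v = 2], on [v = c] for a root [c] of [a], or on
    [f = 0].  These three polynomials have an invertible leading coefficient in
    [z].  Polynomial rings over a field being factorial ([mpoly_factorial]), and
    irreducible hypersurfaces satisfying the Nullstellensatz
    ([prime_nullstellensatz]), [Z] is the zero set of a prime factor [h] of that
    polynomial, and [h] generates the ideal of [Z]
    ([component_prime_hypersurface]).  Hence [Z] is a surface: [x] and [y] are
    independent on it, because each line parallel to the [z]-axis meets it, while
    three polynomials in [x, y, z] are always dependent modulo [h], by counting
    monomials ([dependence_modulo]).  Moreover [Z] is smooth at a point exactly
    when the gradient of [h] is nonzero there, which holds as soon as the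
    gradient of a multiple of [h] is nonzero.

    It remains to find the critical points.  Those of [v] are the origin, where
    [v = -2], and the four central characters, where [v = 2]
    ([commutator_critical]); as [a] does not vanish at [2] and [-2], the
    surfaces [v = c] are smooth.  The surface [f = 0] has no critical point
    ([geometric_no_critical_zero]): this follows from [a^2 - v a b + b^2 = 1],
    which says that [A^n] has determinant 1, and from the formula for the
    derivative of [v a - 2 b], the trace of [A^n].  Finally [v - 2] is prime
    ([cayley_cubic_prime]), so that [v = 2] is itself a component, whose singular
    points are the central characters. *)

(** * Unique factorization in polynomial rings *)

Section PrimeElements.
Variable R : idomainType.
Implicit Types a b c f p q h u : R.

Definition divides a b := exists c, b = c * a.

Definition prime_elt p :=
  [/\ p != 0, p \isn't a GRing.unit &
      forall a b, divides p (a * b) -> divides p a \/ divides p b].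

(** The products of [k] primes and a unit; the number [k] serves as a measure in
    inductions on divisors. *)
Inductive prime_product : nat -> R -> Prop :=
| PrimeProductUnit u : u \is a GRing.unit -> prime_product 0 u
| PrimeProductCons k p a :
    prime_elt p -> prime_product k a -> prime_product k.+1 (p * a).

Definition factorial_ring := forall a, a != 0 -> exists k, prime_product k a.

Lemma divides_refl a : divides a a.
Proof. by exists 1; rewrite mul1r. Qed.

Lemma divides_trans a b c : divides a b -> divides b c -> divides a c.
Proof. by move=> [x ->] [y ->]; exists (y * x); rewrite mulrA. Qed.

Lemma divides_mull a b c : divides a b -> divides a (c * b).
Proof. by move=> [x ->]; exists (c * x); rewrite mulrA. Qed.

Lemma divides_mulr a b c : divides a b -> divides a (b * c).
Proof. by rewrite mulrC; apply: divides_mull. Qed.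

Lemma dividesD a b c : divides a b -> divides a c -> divides a (b + c).
Proof. by move=> [x ->] [y ->]; exists (x + y); rewrite mulrDl. Qed.

Lemma prime_product_unitM u k a :
  u \is a GRing.unit -> prime_product k a -> prime_product k (u * a).
Proof.
move=> uu H; elim: H => {k a} [w uw | k p a pp _ IH].
  by apply: PrimeProductUnit; rewrite unitrM uu.
by rewrite mulrCA; apply: PrimeProductCons.
Qed.

Lemma prime_productM i j a b :
  prime_product i a -> prime_product j b -> prime_product (i + j) (a * b).
Proof.
move=> Ha Hb; elim: Ha => {i a} [u uu | i p a pp _ IH].
  exact: prime_product_unitM.
by rewrite addSn -mulrA; apply: PrimeProductCons.
Qed.

Lemma prime_product_neq0 k a : prime_product k a -> a != 0.
Proof.
elim=> {k a} [u uu | k p a [p0 _ _] _ IH]; last by rewrite mulf_neq0.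
by apply/eqP=> E; rewrite E unitr0 in uu.
Qed.

Lemma prime_product0_unit a : prime_product 0 a -> a \is a GRing.unit.
Proof. by move=> H; inversion H. Qed.

(** The primes of [c] are cancelled one after the other, each of them dividing
    [q] or [h]. *)
Lemma prime_product_split k c f q h :
  prime_product k c -> c * f = q * h ->
  exists i j c1 c2 q' h',
    [/\ prime_product i c1, prime_product j c2, (i + j)%N = k &
        [/\ q = c1 * q', h = c2 * h' & f = q' * h']].
Proof.
move=> H; elim: H f q h => {k c} [u uu | k p c pp ppc IH] f q h E.
  exists 0, 0, u, 1, (u^-1 * q), h; split => //.
  - exact: PrimeProductUnit.
  - by apply: PrimeProductUnit; rewrite unitr1.
  split; rewrite ?mul1r ?mulVKr //.
  by rewrite -mulrA -E mulKr.
have [p0 _ pP] := pp.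
have : divides p (q * h) by exists (c * f); rewrite -E -mulrA mulrC.
case/pP => [[t Et] | [t Et]].
  have /IH : c * f = t * h.
    by apply: (mulfI p0); rewrite mulrA E Et -mulrA mulrCA.
  move=> [i [j [c1 [c2 [q' [h' [H1 H2 H3 [E1 E2 E3]]]]]]]].
  exists i.+1, j, (p * c1), c2, q', h'; split => //.
  - exact: PrimeProductCons.
  - by rewrite addSn H3.
  by split=> //; rewrite Et E1 mulrC mulrA.
have /IH : c * f = q * t.
  by apply: (mulfI p0); rewrite mulrA E Et mulrA mulrC.
move=> [i [j [c1 [c2 [q' [h' [H1 H2 H3 [E1 E2 E3]]]]]]]].
exists i, j.+1, c1, (p * c2), q', h'; split => //.
- exact: PrimeProductCons.
- by rewrite addnS H3.
by split=> //; rewrite Et E2 mulrC mulrA.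
Qed.

End PrimeElements.

Section GaussLemma.
Variable R : idomainType.
Implicit Types f g h : {poly R}.

Lemma divides_polyCP (p : R) f :
  divides p%:P f <-> forall i, divides p f`_i.
Proof.
split=> [[g ->] i | H]; first by rewrite coefMC; exists g`_i.
have [c Hc] := choice H.
exists (\poly_(i < size f) (c i : R)); apply/polyP=> i.
rewrite coefMC coef_poly; case: ltnP => [_|le]; first exact: Hc.
by rewrite nth_default // mul0r.
Qed.

Lemma size_sub_lead f : f != 0 ->
  (size (f - (lead_coef f)%:P * 'X^((size f).-1))%R < size f)%N.
Proof.
move=> f0; have sf : (0 < size f)%N by rewrite size_poly_gt0.
rewrite -(prednK sf) ltnS; apply/leq_sizeP => j.
rewrite coefB mul_polyC coefZ coefXn leq_eqVlt => /orP[/eqP <-|lt].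
  by rewrite eqxx mulr1 subrr.
rewrite gtn_eqF // mulr0 subr0 nth_default //.
by rewrite -(prednK sf).
Qed.

(** Gauss: if [p] divides [f * g], it divides the product of the leading
    coefficients, hence one of the two leading terms, which can be dropped. *)
Lemma prime_polyC (p : R) : prime_elt p -> prime_elt p%:P.
Proof.
move=> [p0 pu pP]; split.
- by rewrite polyC_eq0.
- by rewrite poly_unitE coefC eqxx /= (negbTE pu) andbF.
move=> f g; have [k] := ubnP (size f + size g).
elim: k => // k IH in f g *; rewrite ltnS => le D.
have [-> | f0] := eqVneq f 0; first by left; exists 0; rewrite mul0r.
have [-> | g0] := eqVneq g 0; first by right; exists 0; rewrite mul0r.
have : divides p (lead_coef f * lead_coef g).
  by rewrite -lead_coefM lead_coefE; move/divides_polyCP: D; apply.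
have lead_dvd (h : {poly R}) : divides p (lead_coef h) ->
    divides p%:P ((lead_coef h)%:P * 'X^((size h).-1)).
  by move=> [c ->]; apply: divides_mulr; exists c%:P; rewrite polyCM.
have sub_dvd (a b : {poly R}) : divides p%:P a -> divides p%:P b ->
    divides p%:P (a - b).
  move=> Da [c ->]; apply: dividesD => //.
  by exists (- c); rewrite mulNr.
case/pP => /lead_dvd Dl.
- have lt := size_sub_lead f0.
  have [||D1|D1] := IH (f - (lead_coef f)%:P * 'X^((size f).-1)) g.
  + by apply: leq_trans le; rewrite -addSn leq_add2r.
  + by rewrite mulrBl; apply: sub_dvd => //; apply: divides_mulr.
  + by left; rewrite -[f](subrK ((lead_coef f)%:P * 'X^((size f).-1))); apply: dividesD.
  + by right.
- have lt := size_sub_lead g0.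
  have [||D1|D1] := IH f (g - (lead_coef g)%:P * 'X^((size g).-1)).
  + by apply: leq_trans le; rewrite -addnS leq_add2l.
  + by rewrite mulrBr; apply: sub_dvd => //; apply: divides_mull.
  + by left.
  + by right; rewrite -[g](subrK ((lead_coef g)%:P * 'X^((size g).-1))); apply: dividesD.
Qed.

Lemma prime_product_polyC k (c : R) :
  prime_product k c -> prime_product k c%:P.
Proof.
elim=> {k c} [u uu | k p c pp _ IH].
  by apply: PrimeProductUnit; rewrite rmorph_unit.
by rewrite polyCM; apply: PrimeProductCons => //; apply: prime_polyC.
Qed.

Definition primitive f := forall d : R, divides d%:P f -> d \is a GRing.unit.

Lemma primitive_dvd f g : divides f g -> primitive g -> primitive f.
Proof. by move=> D H d Dd; apply: H; apply: divides_trans D. Qed.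

Hypothesis factR : factorial_ring R.

(** A factorization of [f] over the fraction field of [R], whose common
    denominator is [c], comes from a factorization over [R] with factors of the
    same degrees: by Gauss, the primes of [c] can be removed from [g] and [h]. *)
Lemma poly_split_scalar (c : R) f g h : c != 0 -> f != 0 -> c%:P * f = g * h ->
  exists c1 c2 g' h', [/\ c1 != 0, c2 != 0, g = c1%:P * g', h = c2%:P * h' & f = g' * h'].
Proof.
move=> c0 f0 E; have [k ppc] := factR c0.
have [i [j [c1 [c2 [g' [h' [/prime_product_neq0 H1 /prime_product_neq0 H2 _ [E1 E2 E3]]]]]]]] :=
  prime_product_split (prime_product_polyC ppc) E.
have Ec : c%:P = c1 * c2.
  by apply: (mulIf f0); rewrite E E1 E2 mulrACA -E3.
have [s1 s2] : size c1 = 1%N /\ size c2 = 1%N.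
  have := congr1 (fun x : {poly R} => size x) Ec; rewrite /= size_mul // size_polyC c0 /=.
  move: H1 H2; rewrite -!size_poly_gt0.
  by case: (size c1) (size c2) => [//|[|a]] [//|[|b]] //=; rewrite addnS.
exists (c1`_0), (c2`_0), g', h'.
have D1 : c1 = (c1`_0)%:P by apply: size1_polyC; rewrite s1.
have D2 : c2 = (c2`_0)%:P by apply: size1_polyC; rewrite s2.
by rewrite -D1 -D2; split => //; rewrite -polyC_eq0 -?D1 -?D2.
Qed.

Lemma primitive_dvd_scalar (c : R) f g :
  c != 0 -> primitive f -> divides f (c%:P * g) -> divides f g.
Proof.
move=> c0 pf [t E].
have [-> | g0] := eqVneq g 0; first by exists 0; rewrite mul0r.
have [c1 [c2 [t' [f' [_ _ _ Ef Eg]]]]] := poly_split_scalar c0 g0 E.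
have c2u : c2 \is a GRing.unit by apply: pf; rewrite Ef; exists f'; rewrite mulrC.
exists (t' * c2^-1%:P); rewrite Ef Eg -mulrA; congr (_ * _).
by rewrite mulrA -polyCM mulVr // mul1r.
Qed.

(** A primitive polynomial without factorization into non-constant
    polynomials is prime: it divides every [a] with which it has a
    non-constant common divisor over the fraction field, and otherwise some
    nonzero scalar is a combination of [f] and [a], by Bezout. *)
Lemma primitive_irreducible_prime f :
  (1 < size f)%N -> primitive f ->
  (forall a b, f = a * b -> (size a <= 1)%N \/ (size b <= 1)%N) ->
  prime_elt f.
Proof.
move=> sf pf irr; have f0 : f != 0 by rewrite -size_poly_gt0 ltnW.
split => //.
  by rewrite poly_unitE gtn_eqF.
move=> a b D.
have [[k1 q1] /= k10 E1] := Pdiv.Idomain.dvdpP _ _ (dvdp_gcdl f a).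
have [[k2 q2] /= k20 E2] := Pdiv.Idomain.dvdpP _ _ (dvdp_gcdr f a).
rewrite -!mul_polyC in E1 E2.
have [c1 [c2 [q' [h' [c10 c20 Eq Eh Ef]]]]] := poly_split_scalar k10 f0 E1.
have [sq|sh] := irr _ _ Ef; [left|right].
- have Eq' : q' = (q'`_0)%:P by apply: size1_polyC.
  have uq : q'`_0 \is a GRing.unit by apply: pf; rewrite -Eq' Ef; exists h'; rewrite mulrC.
  apply: (primitive_dvd_scalar k20 pf).
  rewrite E2 Eh; apply: divides_mull; apply: divides_mull.
  exists (q'`_0)^-1%:P; rewrite Ef {2}Eq' mulrA -polyCM mulVr // mul1r //.
- have [[u w] /= ] := Pdiv.Idomain.Bezoutp f a.
  case/Pdiv.Idomain.eqpP => [[d1 d2] /= /andP[d10 d20] Ed].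
  have Eh' : h' = (h'`_0)%:P by apply: size1_polyC.
  have h'0 : h'`_0 != 0.
    by apply: contraNneq f0 => E; rewrite Ef Eh' E mulr0.
  apply: (@primitive_dvd_scalar (d2 * (c2 * h'`_0))) => //; first by rewrite !mulf_neq0.
  rewrite 2!polyCM -Eh' -Eh mul_polyC -Ed -mul_polyC -mulrA.
  apply: divides_mull; rewrite mulrDl; apply: dividesD.
    by exists (u * b); rewrite mulrAC.
  by rewrite -mulrA; apply: divides_mull.
Qed.

(** Nonunit scalars are divided out of [f] as long as possible; each of them
    takes at least one prime away from the leading coefficient. *)
Lemma primitive_part f : f != 0 ->
  exists c f', [/\ c != 0, primitive f' & f = c%:P * f'].
Proof.
move=> f0; have lf0 : lead_coef f != 0 by rewrite lead_coef_eq0.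
have [k] := factR lf0.
have [m] := ubnP k; elim: m => // m IH in k f f0 {lf0} *; rewrite ltnS => le pk.
have [prim|] := pselect (primitive f).
  by exists 1, f; rewrite oner_neq0 mul1r.
move=> /existsNP[d /not_implyP[[f1 Ef] du]].
have f10 : f1 != 0 by apply: contraNneq f0 => E; rewrite Ef E mul0r.
have d0 : d != 0 by apply: contraNneq f0 => E; rewrite Ef E mulr0.
have El : lead_coef f * 1 = d * lead_coef f1.
  by rewrite mulr1 Ef lead_coefM lead_coefC mulrC.
have [i [j [c1 [c2 [q' [h' [H1 H2 H3 [E1 E2 E3]]]]]]]] := prime_product_split pk El.
have /andP[uq uh] : (q' \is a GRing.unit) && (h' \is a GRing.unit).
  by rewrite -unitrM -E3 unitr1.
have i0 : (0 < i)%N.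
  case: i H1 H3 => // /prime_product0_unit H1 _.
  by case: du; rewrite E1 unitrM H1.
have [||c [f' [c0 pf' Ef1]]] := IH j f1 f10.
- by apply: leq_trans le; rewrite -H3 -add1n leq_add2r.
- by rewrite E2 mulrC; apply: prime_product_unitM.
exists (d * c), f'; split => //; first by rewrite mulf_neq0.
by rewrite Ef Ef1 polyCM mulrC mulrA.
Qed.

(** After the content is factored in [R], a primitive polynomial is split into
    factors of smaller degree, until no such splitting exists. *)
Theorem poly_factorial : factorial_ring {poly R}.
Proof.
suff prim f : f != 0 -> primitive f -> exists k, prime_product k f.
  move=> f f0; have [c [f' [c0 pf' Ef]]] := primitive_part f0.
  have [i Hi] := factR c0; have [|j Hj] := prim f' _ pf'.
    by apply: contraNneq f0 => E; rewrite Ef E mulr0.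
  by exists (i + j)%N; rewrite Ef; apply: prime_productM => //; apply: prime_product_polyC.
have [k] := ubnP (size f); elim: k => // k IH in f *; rewrite ltnS => le f0 pf.
have [s1|s1] := leqP (size f) 1.
  exists 0; apply: PrimeProductUnit; rewrite (size1_polyC s1) rmorph_unit //.
  by apply: pf; rewrite -size1_polyC //; apply: divides_refl.
have [irr|] := pselect (forall a b, f = a * b -> (size a <= 1)%N \/ (size b <= 1)%N).
  exists 1%N; rewrite -[f]mulr1; apply: PrimeProductCons.
    exact: primitive_irreducible_prime.
  by apply: PrimeProductUnit; rewrite unitr1.
move=> /existsNP[a /existsNP[b /not_implyP[Ef /not_orP[]]]].
move=> /negP; rewrite -ltnNge => sa /negP; rewrite -ltnNge => sb.
have a0 : a != 0 by apply: contraNneq f0 => E; rewrite Ef E mul0r.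
have b0 : b != 0 by apply: contraNneq f0 => E; rewrite Ef E mulr0.
have sz : size f = (size a + size b).-1 by rewrite Ef size_mul.
have [||i Hi] := IH a _ a0.
- apply: leq_trans le; rewrite sz -(prednK (ltnW sb)) addnS /= -[X in (X < _)%N]addn0 ltn_add2l.
  by rewrite -ltnS prednK // ltnW.
- by apply: primitive_dvd pf; exists b; rewrite mulrC.
have [||j Hj] := IH b _ b0.
- apply: leq_trans le; rewrite sz -(prednK (ltnW sa)) addSn /= -[X in (X < _)%N]add0n ltn_add2r.
  by rewrite -ltnS prednK // ltnW.
- by apply: primitive_dvd pf; exists a.
by exists (i + j)%N; rewrite Ef; apply: prime_productM.
Qed.

End GaussLemma.

Section Transport.
Variables (R S : idomainType) (phi : {rmorphism R -> S}) (psi : {rmorphism S -> R}).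
Hypotheses (phiK : cancel phi psi) (psiK : cancel psi phi).

Lemma divides_iso a b : divides (phi a) (phi b) <-> divides a b.
Proof.
split=> [[c E] | [c ->]]; last by exists (phi c); rewrite rmorphM.
by exists (psi c); rewrite -[b]phiK E rmorphM phiK.
Qed.

Lemma unit_iso a : (phi a \is a GRing.unit) = (a \is a GRing.unit).
Proof. by apply/idP/idP=> [/(rmorph_unit psi)|/(rmorph_unit phi)//]; rewrite phiK. Qed.

Lemma prime_iso p : prime_elt (phi p) -> prime_elt p.
Proof.
move=> [p0 pu pP]; split.
- by apply: contraNneq p0 => ->; rewrite rmorph0.
- by rewrite -unit_iso.
move=> a b /divides_iso; rewrite rmorphM => /pP.
by case=> /divides_iso; [left|right].
Qed.

Lemma factorial_iso : factorial_ring S -> factorial_ring R.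
Proof.
move=> fS a a0; have [|k H] := fS (phi a).
  by apply: contraNneq a0 => E; rewrite -[a]phiK E rmorph0.
exists k; rewrite -[a]phiK; move: (phi a) H => b H.
elim: H => {k b} [u uu | k p b pp _ IH].
  by apply: PrimeProductUnit; rewrite rmorph_unit.
rewrite rmorphM; apply: PrimeProductCons => //.
by apply: prime_iso; rewrite psiK.
Qed.
End Transport.

(** * Polynomials in several variables *)

(** The identities between substitutions used below are all obtained by
    comparing two ring morphisms on constants and variables. *)
Lemma mpoly_morph_ext (n : nat) (K : comNzRingType) (S : nzRingType)
    (f h : {rmorphism {mpoly K[n]} -> S}) :
  (forall c, f c%:MP = h c%:MP) -> (forall i, f 'X_i = h 'X_i) -> f =1 h.
Proof.
move=> EC EX; elim/mpolyind=> [|c m q _ _ IH]; first by rewrite !rmorph0.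
rewrite !rmorphD IH -mul_mpolyC !rmorphM EC mpolyXE_id !rmorph_prod.
by congr (_ * _ + _); apply: eq_bigr => i _; rewrite !rmorphXn EX.
Qed.

Lemma mderivXU (n : nat) (K : nzRingType) (i j : 'I_n) :
  ('X_j : {mpoly K[n]})^`M(i) = (i == j)%:R%:MP.
Proof.
rewrite mderivX mnm1E eq_sym; case: eqP => [->|_]; last by rewrite scale0r mpolyC0.
rewrite scale1r mpolyC1 (_ : (_ - _)%MM = 0%MM) ?mpolyX0 //.
by apply/mnmP=> k; rewrite mnmE subnn mnmE.
Qed.

Section MpolyMorphisms.
Variables (n : nat) (K : comNzRingType).

(** The inverse of [muni], which isolates the last variable. *)
Definition of_muni (p : {poly {mpoly K[n]}}) : {mpoly K[n.+1]} :=
  (map_poly (@mwiden n K) p).['X_ord_max].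

Fact of_muni_additive : additive of_muni.
Proof. by move=> p q; rewrite /of_muni rmorphB hornerD hornerN. Qed.

Fact of_muni_multiplicative : multiplicative of_muni.
Proof.
split=> [p q|]; rewrite /of_muni ?rmorphM ?rmorph1 ?hornerM ?hornerC //.
Qed.

HB.instance Definition _ := GRing.isAdditive.Build _ _ of_muni of_muni_additive.
HB.instance Definition _ :=
  GRing.isMultiplicative.Build _ _ of_muni of_muni_multiplicative.

Lemma muniX_max : muni ('X_ord_max : {mpoly K[n.+1]}) = 'X.
Proof.
rewrite muniE msuppX big_seq1 mcoeffX eqxx scale1r.
rewrite (_ : [multinom _ | _ < _] = 0%MM) ?mpolyX0.
  by rewrite scale1r mnm1E eqxx expr1.
apply/mnmP=> i; rewrite !mnmE; case: eqP => // E.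
by have := ltn_ord i; rewrite -[X in (_ < X)%N]/(nat_of_ord (@ord_max n)) E ltnn.
Qed.

Lemma muniX_widen (i : 'I_n) :
  muni ('X_(widen_ord (leqnSn n) i) : {mpoly K[n.+1]}) = ('X_i)%:P.
Proof.
rewrite muniE msuppX big_seq1 mcoeffX eqxx scale1r mnm1E.
rewrite (_ : widen_ord _ _ == ord_max = false); last first.
  by apply/negP=> /eqP E; have := ltn_ord i; rewrite -[X in (X < _)%N]/(nat_of_ord (widen_ord (leqnSn n) i)) E ltnn.
rewrite expr0 alg_polyC; congr (_%:P); congr ('X_[_]).
by apply/mnmP=> j; rewrite !mnmE; congr (nat_of_bool _); apply/eqP/eqP=> [E|->//]; apply/val_inj; have /= := congr1 val E.
Qed.

Lemma of_muni_polyC p : of_muni p%:P = mwiden p.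
Proof. by rewrite /of_muni map_polyC hornerC. Qed.

Lemma of_muniX : of_muni 'X = 'X_ord_max.
Proof. by rewrite /of_muni map_polyX hornerX. Qed.

Lemma mwidenXU (i : 'I_n) : mwiden ('X_i : {mpoly K[n]}) = 'X_(widen_ord (leqnSn n) i).
Proof. by rewrite mwidenX mnmwiden1. Qed.

Lemma ord_max_or_widen (i : 'I_n.+1) :
  i = ord_max \/ exists j, i = widen_ord (leqnSn n) j.
Proof.
have := ltn_ord i; rewrite ltnS leq_eqVlt => /orP[/eqP E | lt].
  by left; apply/val_inj.
by right; exists (Ordinal lt); apply/val_inj.
Qed.

Lemma muniK : cancel (@muni n K) of_muni.
Proof.
suff H : of_muni \o @muni n K =1 idfun by [].
apply: mpoly_morph_ext => [c|i] /=.
  by rewrite muniC of_muni_polyC mwidenC.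
by case: (ord_max_or_widen i) => [->|[j ->]];
  rewrite ?muniX_max ?of_muniX // muniX_widen of_muni_polyC mwidenXU.
Qed.

Lemma muni_mwiden (p : {mpoly K[n]}) : muni (mwiden p) = p%:P.
Proof.
move: p; suff H : @muni n K \o @mwiden n K =1 polyC by [].
apply: mpoly_morph_ext => [c|i] /=.
  by rewrite mwidenC muniC.
by rewrite mwidenXU muniX_widen.
Qed.

Lemma of_muniK : cancel of_muni (@muni n K).
Proof.
elim/poly_ind=> [|p c IH]; first by rewrite !rmorph0.
by rewrite !rmorphD !rmorphM /= IH of_muniX muniX_max of_muni_polyC muni_mwiden.
Qed.

Lemma meval_muni (v : 'I_n.+1 -> K) (q : {mpoly K[n.+1]}) :
  q.@[v] = (map_poly (meval (v \o widen_ord (leqnSn n))) (muni q)).[v ord_max].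
Proof.
move: q; suff H : meval v =1 horner_eval (v ord_max)
  \o map_poly (meval (v \o widen_ord (leqnSn n))) \o @muni n K by [].
apply: mpoly_morph_ext => [c|i] /=; rewrite /horner_eval.
  by rewrite mevalC muniC map_polyC hornerC /= mevalC.
rewrite mevalXU; case: (ord_max_or_widen i) => [->|[j ->]].
  by rewrite muniX_max map_polyX hornerX.
by rewrite muniX_widen map_polyC hornerC /= mevalXU.
Qed.

End MpolyMorphisms.

Definition extend_point (T : Type) n (w : 'I_n -> T) (t : T) (i : 'I_n.+1) : T :=
  if unlift ord_max i is Some j then w j else t.

Lemma extend_point_max T n (w : 'I_n -> T) t : extend_point w t ord_max = t.
Proof. by rewrite /extend_point unlift_none. Qed.

Lemma extend_point_widen T n (w : 'I_n -> T) t :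
  extend_point w t \o widen_ord (leqnSn n) =1 w.
Proof.
move=> i /=; rewrite /extend_point.
have -> : widen_ord (leqnSn n) i = lift ord_max i.
  by apply/val_inj; rewrite /= /bump leqNgt ltn_ord.
by rewrite liftK.
Qed.

Lemma meval_extend (K : comNzRingType) n (w : 'I_n -> K) t (q : {mpoly K[n.+1]}) :
  q.@[extend_point w t] = (map_poly (meval w) (muni q)).[t].
Proof.
rewrite meval_muni extend_point_max; congr (_.[_]).
by apply: eq_map_poly => p; apply: meval_eq; apply: extend_point_widen.
Qed.

Section MpolyFactorial.
Variable K : fieldType.

Lemma mpoly0_const (p : {mpoly K[0]}) : p = (p@_0%MM)%:MP.
Proof.
apply/mpolyP=> m; rewrite mcoeffC.
have -> : m = 0%MM by apply/mnmP; case.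
by rewrite eqxx mulr1.
Qed.

Theorem mpoly_factorial n : factorial_ring {mpoly K[n]}.
Proof.
elim: n => [|n IH].
  move=> p p0; exists 0; apply: PrimeProductUnit.
  rewrite (mpoly0_const p); apply: (@rmorph_unit _ _ (@mpolyC 0 K)).
  by rewrite unitfE; apply: contraNneq p0 => E; rewrite (mpoly0_const p) E mpolyC0.
exact: (factorial_iso (@muniK n K) (@of_muniK n K) (poly_factorial IH)).
Qed.

Lemma prime_muni n (g : {mpoly K[n.+1]}) : prime_elt g -> prime_elt (muni g).
Proof.
by move=> pg; apply: (prime_iso (@of_muniK n K)); rewrite /= muniK.
Qed.

Lemma unit_muni n (g : {mpoly K[n.+1]}) :
  (muni g \is a GRing.unit) = (g \is a GRing.unit).
Proof. exact: (unit_iso (@muniK n K)). Qed.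

Lemma divides_muni n (g q : {mpoly K[n.+1]}) :
  divides (muni g) (muni q) -> divides g q.
Proof. by move/(divides_iso (@muniK n K)). Qed.
End MpolyFactorial.

Section Nullstellensatz.
Variable K : closedFieldType.

Lemma mpoly_nonroot n (g : {mpoly K[n]}) : g != 0 -> exists v, g.@[v] != 0.
Proof.
elim: n g => [|n IH] g g0.
  exists (fun=> 0); rewrite (mpoly0_const g) mevalC.
  by apply: contraNneq g0 => E; rewrite (mpoly0_const g) E mpolyC0.
have m0 : muni g != 0.
  by apply: contraNneq g0 => E; rewrite -[g]muniK E rmorph0.
have [|w Hw] := IH (lead_coef (muni g)); first by rewrite lead_coef_eq0.
have /closed_nonrootP[t Ht] : map_poly (meval w) (muni g) != 0.
  by rewrite -lead_coef_eq0 lead_coef_map_eq.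
by exists (extend_point w t); rewrite meval_extend.
Qed.

Lemma meval_combination n (v : 'I_n -> K) (t : K) (c e : {mpoly K[n]})
    (a b f h : {poly {mpoly K[n]}}) :
  c%:P = e%:P * (a * f + b * h) -> (map_poly (meval v) f).[t] = 0 ->
  (map_poly (meval v) h).[t] = 0 -> c.@[v] = 0.
Proof.
pose ev : {rmorphism {poly {mpoly K[n]}} -> K} := horner_eval t \o map_poly (meval v).
move=> E Ef Eh; have -> : c.@[v] = ev c%:P by rewrite /ev /= map_polyC /horner_eval hornerC.
by rewrite E rmorphM rmorphD !rmorphM [ev f]Ef [ev h]Eh !mulr0 addr0 mulr0.
Qed.

(** Nullstellensatz for a prime hypersurface [g = 0] on which the last
    coordinate is not constant: if [g] did not divide [q], some nonzero
    polynomial [d] in the other variables would be a combination of [g] and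
    [q]; over a point where neither [d] nor the leading coefficient of [g]
    vanishes, [g] has a zero, at which [q] vanishes, hence also [d]. *)
Lemma prime_nullstellensatz n (g q : {mpoly K[n.+1]}) :
  prime_elt g -> (1 < size (muni g))%N ->
  (forall v, g.@[v] = 0 -> q.@[v] = 0) -> divides g q.
Proof.
move=> pg sg van; apply: divides_muni; apply: contrapT => ndiv.
have [g0 gu gP] := prime_muni pg; set G := muni g in g0 gu gP sg ndiv; set Q := muni q in ndiv.
have [[k1 q1] /= k10 E1] := Pdiv.Idomain.dvdpP _ _ (dvdp_gcdl G Q).
have [[k2 q2] /= k20 E2] := Pdiv.Idomain.dvdpP _ _ (dvdp_gcdr G Q).
rewrite -!mul_polyC in E1 E2.
have ndivC c : c != 0 -> ~ divides G c%:P.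
  move=> c0 [t E]; have := congr1 (fun x : {poly _} => size x) E.
  have t0 : t != 0 by apply: contraNneq c0 => Et; rewrite Et mul0r in E; rewrite -polyC_eq0 E.
  rewrite size_polyC c0 size_mul //=; move: t0; rewrite -size_poly_gt0.
  by move: (size t) (size G) sg => a b; lia.
have ndivh : ~ divides G (gcdp G Q).
  move=> D; have : divides G (k2%:P * Q) by rewrite E2; apply: divides_mull.
  by case/gP => // /(ndivC _ k20).
have [k Ek] : divides G q1.
  have : divides G (q1 * gcdp G Q) by rewrite -E1; exists k1%:P.
  by case/gP.
have sh : (size (gcdp G Q) <= 1)%N.
  have E : k1%:P = k * gcdp G Q.
    by apply: (mulfI g0); rewrite mulrC E1 Ek; ring.
  have /andP[kn0 hn0] : (k != 0) && (gcdp G Q != 0).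
    by rewrite -negb_or -mulf_eq0 -E polyC_eq0.
  have := congr1 (fun x : {poly _} => size x) E; rewrite size_polyC k10 size_mul //=.
  move: kn0 hn0; rewrite -!size_poly_gt0.
  by move: (size k) (size (gcdp G Q)) => a b; lia.
have [[u w] /= ] := Pdiv.Idomain.Bezoutp G Q.
case/Pdiv.Idomain.eqpP => [[d1 d2] /= /andP[d10 d20] Ed].
have h0 : gcdp G Q != 0.
  by apply/eqP=> E; apply: ndivh; rewrite E; exists 0; rewrite mul0r.
set d := d2 * (gcdp G Q)`_0.
have Ed' : d%:P = d1%:P * (u * G + w * Q).
  by rewrite mul_polyC Ed [in RHS](size1_polyC sh) -mul_polyC -polyCM.
have d0 : d != 0.
  rewrite mulf_neq0 //; apply: contraNneq h0 => E; by rewrite (size1_polyC sh) E.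
have [|v] := @mpoly_nonroot _ (d * lead_coef G); first by rewrite mulf_neq0 // lead_coef_eq0.
rewrite mevalM mulf_eq0 negb_or => /andP[dv lv].
have /closed_rootP[t /eqP rt] : size (map_poly (meval v) G) != 1%N.
  by rewrite size_map_poly_id0 // gtn_eqF.
have rq : (map_poly (meval v) Q).[t] = 0.
  by rewrite -meval_extend; apply: van; rewrite meval_extend.
move/eqP: dv; apply.
exact: meval_combination Ed' rt rq.
Qed.

End Nullstellensatz.

(** * Algebraic dependence *)

Section AlgebraicDependence.
Variable K : fieldType.

(** More vectors than coordinates: [c i] is the [i]-th vector. *)
Lemma linear_dependence (I J : finType) (c : I -> J -> K) : (#|J| < #|I|)%N ->
  exists2 x : I -> K, exists i, x i != 0 & forall j, \sum_i x i * c i j = 0.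
Proof.
move=> lt; pose A : 'M[K]_(#|I|, #|J|) := \matrix_(i, j) c (enum_val i) (enum_val j).
have : kermx A != 0.
  rewrite kermx_eq0 /row_free neq_ltn (leq_ltn_trans (rank_leq_col A)) //.
case/rowV0Pn => v /sub_kermxP vA v0.
exists (fun i => v 0 (enum_rank i)).
  have [i vi] : exists i, v 0 i != 0.
    apply: contrapT => /forallNP H; case/negP: v0; apply/eqP/rowP=> i.
    by rewrite mxE; apply/eqP; apply/negPn/negP/H.
  by exists (enum_val i); rewrite enum_valK.
move=> j; have E : \sum_k v 0 k * A k (enum_rank j) = 0.
  by have := congr1 (fun B : 'rV_#|J| => B 0 (enum_rank j)) vA; rewrite !mxE.
rewrite -[RHS]E (reindex (@enum_val I I)) /=; last exact/onW_bij/enum_val_bij.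
by apply: eq_bigr => i _; rewrite !mxE enum_valK enum_rankK.
Qed.

Lemma msize_prod_exp n k (a : 'I_k -> {mpoly K[n]}) (e : 'I_k -> nat) D N :
  (forall i, (msize (a i) <= D.+1)%N) -> (forall i, (e i <= N)%N) ->
  (msize (\prod_i a i ^+ e i)%R <= (k * (N * D)).+1)%N.
Proof.
move=> aD eN.
have mulle (p q : {mpoly K[n]}) s t : (msize p <= s.+1)%N -> (msize q <= t.+1)%N ->
    (msize (p * q)%R <= (s + t).+1)%N.
  have [->|p0] := eqVneq p 0; first by rewrite mul0r msize0.
  have [->|q0] := eqVneq q 0; first by rewrite mulr0 msize0.
  by rewrite msizeM // => Hp Hq; have := leq_add Hp Hq; rewrite addSn addnS; case: (_ + _)%N.
have expN i : (msize (a i ^+ e i)%R <= (e i * D).+1)%N.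
  elim: (e i) => [|s IH]; first by rewrite expr0 msize1.
  by rewrite exprS mulSn; apply: mulle.
have : (msize (\prod_i a i ^+ e i)%R <= (\sum_(i < k) e i * D).+1)%N.
  elim/big_rec2: _ => [|i s p _ IH]; first by rewrite msize1.
  exact: mulle.
move/leq_trans; apply; rewrite ltnS.
apply: leq_trans (_ : (\sum_(i < k) N * D <= _)%N); last by rewrite sum_nat_const card_ord.
by apply: leq_sum => i _; rewrite leq_mul2r eN orbT.
Qed.

(** The [N ^ (n + 1)] monomials in the [n + 1] polynomials [a_i] with exponents
    less than [N] lie in a space of polynomials of dimension [O(N ^ n)]. *)
Theorem algebraic_dependence n (a : n.+1.-tuple {mpoly K[n]}) :
  exists2 Q : {mpoly K[n.+1]}, Q != 0 & Q \mPo a = 0.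
Proof.
pose D := (\max_(i < n.+1) msize (tnth a i))%N.
have aD i : (msize (tnth a i) <= D.+1)%N by apply/leqW/(@leq_bigmax _ (fun i => msize (tnth a i))).
(* The products below have degree at most [(n + 1) N D < M = B N], and [N] is
   chosen such that [M ^ n = B ^ n N ^ n < N ^ (n + 1)]. *)
pose B := (n.+1 * D).+1; pose N := (B ^ n).+1; pose M := (B * N)%N.
have NM : ((n.+1 * (N * D)).+1 <= M)%N.
  by rewrite /M /B [X in (_ <= X)%N]mulSn -mulnA (mulnC D) -[X in (X <= _)%N]add1n leq_add2r.
pose mon k L (e : {ffun 'I_k -> 'I_L}) : 'X_{1..k} := [multinom (e i : nat) | i < k].
pose c (e : {ffun 'I_n.+1 -> 'I_N}) (m : 'X_{1..n}) := ('X_[mon _ _ e] \mPo a)@_m.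
have [|x [e0 x0] Hx] := @linear_dependence {ffun 'I_n.+1 -> 'I_N} {ffun 'I_n -> 'I_M}
    (fun e f => c e (mon _ _ f)).
  by rewrite !card_ffun !card_ord /M expnMn expnS ltn_pmul2r ?expn_gt0.
exists (\sum_e x e *: 'X_[mon _ _ e]).
  apply: contraNneq x0 => /(congr1 (mcoeff (mon _ _ e0))).
  rewrite mcoeff0 raddf_sum /= (bigD1 e0) //= mcoeffZ mcoeffX eqxx mulr1 big1 ?addr0 => [->//|e ne].
  rewrite mcoeffZ mcoeffX; case: eqP => [E|_]; last by rewrite mulr0.
  case/eqP: ne; apply/ffunP=> i; apply/val_inj; have := congr1 (fun m : 'X_{1..n.+1} => m i) E.
  by rewrite !mnmE.
rewrite raddf_sum /=; apply/mpolyP=> m; rewrite mcoeff0 raddf_sum /=.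
under eq_bigr do rewrite comp_mpolyZ mcoeffZ.
have [mM|] := pselect (forall i, (m i < M)%N).
  rewrite -[RHS](Hx [ffun i => Ordinal (mM i)]); apply: eq_bigr => e _; congr (_ * mcoeff _ _).
  by apply/mnmP=> i; rewrite mnmE ffunE.
move=> /existsNP[i /negP]; rewrite -leqNgt => le; apply: big1 => e _.
rewrite (memN_msupp_eq0 (msize_mdeg_ge _)) ?mulr0 //.
rewrite comp_mpolyX; apply: leq_trans (msize_prod_exp aD _) _.
  by move=> j; rewrite mnmE; apply/ltnW/ltn_ord.
apply: leq_trans NM (leq_trans le _).
by rewrite mdegE (bigD1 i) //= leq_addr.
Qed.

(** A relation between [a_1, ..., a_n, g], divided by its last variable as often
    as possible, has a nonzero part without [g]; this part is a relation between
    the [a_i] modulo [g]. *)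
Lemma dependence_modulo n (g : {mpoly K[n]}) (a : n.-tuple {mpoly K[n]}) : g != 0 ->
  exists2 Q : {mpoly K[n]}, Q != 0 & divides g (Q \mPo a).
Proof.
move=> g0; have [Q Q0 EQ] := algebraic_dependence [tuple of rcons a g].
have comp_muni (P : {mpoly K[n.+1]}) :
    P \mPo [tuple of rcons a g] = (map_poly (comp_mpoly a) (muni P)).[g].
  move: P; suff H : comp_mpoly [tuple of rcons a g] =1
    horner_eval g \o map_poly (comp_mpoly a) \o @muni n K by [].
  apply: mpoly_morph_ext => [c|i] /=; rewrite /horner_eval.
    by rewrite comp_mpolyC muniC map_polyC hornerC /= comp_mpolyC.
  rewrite comp_mpolyXU; case: (ord_max_or_widen i) => [->|[j ->]].
    rewrite muniX_max map_polyX hornerX /= nth_rcons size_tuple ltnn eqxx //.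
  rewrite muniX_widen map_polyC hornerC /= comp_mpolyXU nth_rcons size_tuple.
  by rewrite ltn_ord.
have {EQ} : (map_poly (comp_mpoly a) (muni Q)).[g] = 0 by rewrite -comp_muni.
have : muni Q != 0 by apply: contraNneq Q0 => E; rewrite -[Q]muniK E rmorph0.
elim/poly_ind: (muni Q) => [|P c IH]; first by rewrite eqxx.
have [-> | c0] := eqVneq c 0.
  rewrite addr0 mulf_eq0 polyX_eq0 orbF => P0.
  rewrite rmorphM /= map_polyX hornerM hornerX => /eqP.
  by rewrite mulf_eq0 (negbTE g0) orbF => /eqP; apply: IH.
move=> _; rewrite rmorphD rmorphM /= map_polyX map_polyC hornerD hornerM hornerX hornerC.
move=> /eqP; rewrite addrC addr_eq0 => /eqP E; exists c => //.
by rewrite [_ \mPo _]E; exists (- (map_poly (comp_mpoly a) P).[g]); rewrite mulNr.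
Qed.

End AlgebraicDependence.

(** * Components of hypersurfaces *)

Section Hypersurfaces.
Variable K : fieldType.
Implicit Types (X Z A B : set 'rV[K]_3) (p : 'rV[K]_3) (f g q : {mpoly K[3]}).

Definition hypersurface g : set 'rV[K]_3 := [set p | peval g p = 0].

Lemma hypersurface_closed g : zariski_closed (hypersurface g).
Proof.
exists [set g]; apply/seteqP; split=> p /=; first by move=> H q ->.
by apply.
Qed.

Lemma pevalM f g p : peval (f * g) p = peval f p * peval g p.
Proof. by rewrite /peval mevalM. Qed.

Lemma hypersurfaceM f g : hypersurface (f * g) = hypersurface f `|` hypersurface g.
Proof.
apply/seteqP; split=> p /=; rewrite /hypersurface /= pevalM.
  by move/eqP; rewrite mulf_eq0 => /orP[/eqP|/eqP]; [left|right].
by case=> ->; rewrite ?mul0r ?mulr0.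
Qed.

Lemma divides_hypersurface f g : divides f g -> hypersurface f `<=` hypersurface g.
Proof. by move=> [c ->]; rewrite hypersurfaceM => p; right. Qed.

Lemma irreducible_sub_hypersurfaceM Z f g : zariski_irreducible Z ->
  Z `<=` hypersurface (f * g) -> Z `<=` hypersurface f \/ Z `<=` hypersurface g.
Proof.
move=> [_ irr]; rewrite hypersurfaceM; apply: irr; exact: hypersurface_closed.
Qed.

Lemma peval_unit g p : g \is a GRing.unit -> peval g p != 0.
Proof. by move=> /(rmorph_unit (meval (fun i => p 0 i))); rewrite unitfE. Qed.

(** Since [g] is a product of primes, [Z] is covered by their zero sets. *)
Lemma irreducible_sub_prime Z g : zariski_irreducible Z -> g != 0 ->
  Z `<=` hypersurface g ->
  exists h, [/\ prime_elt h, divides h g & Z `<=` hypersurface h].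
Proof.
move=> irrZ /mpoly_factorial[k H]; elim: H => {k g} [u uu | k h g ph _ IH] sub.
  by case: irrZ => [[p /sub Hp] _]; have := peval_unit p uu; rewrite Hp eqxx.
case: (irreducible_sub_hypersurfaceM irrZ sub) => [subh | /IH[h' [ph' dh' sub']]].
  by exists h; split => //; exists g; rewrite mulrC.
by exists h'; split => //; apply: divides_mull.
Qed.

(** Noether position: the projection of [g = 0] to the plane of the first two
    coordinates is finite and onto. *)
Definition noether_position g :=
  (1 < size (muni g))%N && (lead_coef (muni g) \is a GRing.unit).

Lemma noether_position_neq0 g : noether_position g -> g != 0.
Proof. by move=> /andP[+ _]; apply: contraTneq => ->; rewrite rmorph0 size_poly0. Qed.

(** The leading coefficient of a factor of [h] is invertible as well, so that a
    factor that is constant in the last variable is a unit. *)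
Lemma noether_position_factor g h :
  g \isn't a GRing.unit -> divides g h -> noether_position h -> noether_position g.
Proof.
move=> gu [c ->] /andP[_]; rewrite rmorphM lead_coefM unitrM => /andP[_ lu].
apply/andP; split => //; rewrite ltnNge; apply: contra gu => sg.
have {}lu : lead_coef (muni g) \is a GRing.unit := lu.
have s1 : size (muni g) = 1%N.
  apply/eqP; rewrite eqn_leq sg size_poly_gt0.
  by apply: contraTneq lu => ->; rewrite lead_coef0 unitr0.
by rewrite -unit_muni poly_unitE s1; move: lu; rewrite lead_coefE s1.
Qed.

Definition gradient g p : 'cV[K]_3 := \col_i peval g^`M(i) p.

Lemma gradientM f g p : gradient (f * g) p =
  peval f p *: gradient g p + peval g p *: gradient f p.
Proof.
apply/colP=> i; rewrite !mxE mderivM /peval mevalD !mevalM.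
by rewrite addrC; congr (_ + _); rewrite mulrC.
Qed.

End Hypersurfaces.

Section ClosedFieldHypersurfaces.
Variable K : closedFieldType.
Implicit Types (X Z A B : set 'rV[K]_3) (p : 'rV[K]_3) (f g q : {mpoly K[3]}).

(** Over [w], [g] becomes a polynomial in one variable whose degree does not
    drop. *)
Lemma noether_position_lift g (w : 'I_2 -> K) : noether_position g ->
  exists2 p, hypersurface g p & forall i, p 0 (widen_ord (leqnSn 2) i) = w i.
Proof.
move=> /andP[sg lu].
have lw : meval w (lead_coef (muni g)) != 0.
  by rewrite -unitfE; apply: rmorph_unit.
have /closed_rootP[t /eqP rt] : size (map_poly (meval w) (muni g)) != 1%N.
  by rewrite size_map_poly_id0 // gtn_eqF.
exists (\row_i extend_point w t i); last first.
  by move=> i; rewrite mxE; apply: extend_point_widen.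
rewrite /hypersurface /= /peval -rt -meval_extend.
by apply: meval_eq => i; rewrite mxE.
Qed.

Section PrimeHypersurface.
Variable g : {mpoly K[3]}.
Hypotheses (prime_g : prime_elt g) (np_g : noether_position g).

Lemma vanishing_ideal_prime q : vanishing_ideal (hypersurface g) q <-> divides g q.
Proof.
split=> [van | dv p]; last exact: divides_hypersurface.
have /andP[sg _] := np_g; apply: prime_nullstellensatz => // v gv.
have E f : f.@[v] = peval f (\row_i v i) by apply: meval_eq => i; rewrite mxE.
by rewrite E; apply: van; rewrite /hypersurface /= -E.
Qed.

(** If neither [A] nor [B] contains the hypersurface, equations of [A] and [B]
    not divisible by [g] have a product that is divisible by [g]. *)
Lemma prime_hypersurface_irreducible : zariski_irreducible (hypersurface g).
Proof.
split; first by have [p Hp _] := noether_position_lift (fun=> 0) np_g; exists p.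
move=> A B [FA ->] [FB ->] sub; apply: contrapT => /not_orP[].
have nsub (F : set {mpoly K[3]}) : ~ hypersurface g `<=` zero_locus F ->
    exists2 q, F q & ~ divides g q.
  move=> H; apply: contrapT => H1; apply: H => p gp q Fq.
  have : divides g q by apply: contrapT => nd; apply: H1; exists q.
  by move/divides_hypersurface; apply.
move=> /nsub[qA FqA nA] /nsub[qB FqB nB].
have [_ _ gP] := prime_g.
have : divides g (qA * qB).
  apply/vanishing_ideal_prime => p /sub[/(_ _ FqA)|/(_ _ FqB)] E;
    by rewrite pevalM E ?mul0r ?mulr0.
by case/gP.
Qed.

(** The first two coordinates are independent because the projection to them is
    onto; [dependence_modulo] bounds the dimension from above. *)
Lemma prime_hypersurface_dimension : has_dimension (hypersurface g) 2.
Proof.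
split.
  exists [tuple 'X_(widen_ord (leqnSn 2) i) | i < 2] => P van.
  apply: contrapT => /eqP/mpoly_nonroot[w /eqP]; apply.
  have [p gp pw] := noether_position_lift w np_g.
  rewrite -(van p gp) /peval comp_mpoly_meval.
  by apply: meval_eq => i; rewrite tnth_mktuple mevalXU pw.
move=> [a ind]; have [Q Q0 /divides_hypersurface D] := dependence_modulo a (noether_position_neq0 np_g).
by move/eqP: Q0; apply; apply: ind => p gp; apply: D.
Qed.

(** On the zero set of [g], the differential of [c * g] is [c] times that of
    [g]. *)
Lemma tangent_space_prime p (w : 'rV[K]_3) : hypersurface g p ->
  tangent_space (hypersurface g) p w <-> w *m gradient g p = 0.
Proof.
move=> gp; have E f : (\sum_(i < 3) peval f^`M(i) p * w 0 i) =
    (w *m (\col_i peval f^`M(i) p)) 0 0.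
  by rewrite mxE; apply: eq_bigr => i _; rewrite mxE mulrC.
split=> [H | H q /vanishing_ideal_prime[c ->]].
  apply/matrixP=> i j; rewrite !ord1 [RHS]mxE -E; apply: H.
  by apply/vanishing_ideal_prime; apply: divides_refl.
transitivity (peval c p * (w *m gradient g p) 0 0); last by rewrite H mxE mulr0.
rewrite -E mulr_sumr; apply: eq_bigr => i _.
rewrite mulrA -pevalM mderivM /peval mevalD !mevalM -!/(peval _ p).
by rewrite gp mulr0 add0r.
Qed.

Lemma prime_hypersurface_smooth_at p : hypersurface g p ->
  smooth_at (hypersurface g) p <-> gradient g p != 0.
Proof.
move=> gp; split.
  move=> [d dimd [W rW HW]]; apply/eqP => grad0.
  have fullW : (1%:M <= W)%MS.
    by apply/row_subP=> i; apply/HW/tangent_space_prime => //; rewrite grad0 mulmx0.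
  have d3 : d = 3 by rewrite -rW; apply/eqP; rewrite -/(row_full W) -sub1mx.
  rewrite d3 in dimd; case: dimd => + _; exact: prime_hypersurface_dimension.2.
move=> grad0; exists 2; first exact: prime_hypersurface_dimension.
exists (kermx (gradient g p)).
  have : \rank (gradient g p) = 1%N.
    apply/eqP; rewrite eqn_leq rank_leq_col lt0n mxrank_eq0 //.
  by rewrite mxrank_ker => ->.
move=> w; rewrite tangent_space_prime //.
by split=> [/sub_kermxP | /sub_kermxP].
Qed.

End PrimeHypersurface.

(** [Z] lies on the zero set of a prime factor of [g], which is irreducible and
    contained in [X], so that both coincide by maximality of [Z]. *)
Lemma component_prime_hypersurface X Z g :
  irreducible_component X Z -> noether_position g ->
  hypersurface g `<=` X -> Z `<=` hypersurface g ->
  exists h, [/\ prime_elt h, divides h g, noether_position h & Z = hypersurface h].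
Proof.
move=> [_ irrZ _ maxZ] npg gX Zg.
have [h [ph dh Zh]] := irreducible_sub_prime irrZ (noether_position_neq0 npg) Zg.
have nph : noether_position h by apply: noether_position_factor dh npg; case: ph.
exists h; split => //; apply/esym/maxZ => //.
- exact: hypersurface_closed.
- exact: prime_hypersurface_irreducible.
- by apply: subset_trans gX; apply: divides_hypersurface.
Qed.

Lemma prime_hypersurface_surface g :
  prime_elt g -> noether_position g -> surface (hypersurface g).
Proof.
move=> pg npg; split; [exact: hypersurface_closed | exact: prime_hypersurface_irreducible |].
exact: prime_hypersurface_dimension.
Qed.

(** A factor of [g] has no more critical zeros than [g]. *)
Lemma component_smooth_surface X Z g :
  irreducible_component X Z -> noether_position g ->
  hypersurface g `<=` X -> Z `<=` hypersurface g ->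
  (forall p, Z p -> gradient g p != 0) -> smooth_surface Z.
Proof.
move=> compZ npg gX Zg grad.
have [h [ph [c Eg] nph EZ]] := component_prime_hypersurface compZ npg gX Zg.
rewrite EZ in grad *; split; first exact: prime_hypersurface_surface.
move=> p hp; apply/prime_hypersurface_smooth_at => //.
apply: contraNneq (grad p hp) => gh0.
by rewrite Eg gradientM gh0 (hp : peval h p = 0) scale0r scaler0 addr0.
Qed.

End ClosedFieldHypersurfaces.

(** * Powers in SL_2 and Chebyshev polynomials *)

Section ChebyshevPairs.
Variable K : fieldType.
Implicit Types a b : {poly K}.

(** The pair [(a, b)] with [A ^ n = a(tr A) A - b(tr A)] for [A] in [SL_2]; these
    are the Chebyshev polynomials [S_(n-1)] and [S_(n-2)]. *)
Fixpoint power_coefs_nat (n : nat) : {poly K} * {poly K} :=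
  if n is n'.+1 then
    let: (a, b) := power_coefs_nat n' in ('X * a - b, a)
  else (0, -1).

Definition power_coefs (n : int) : {poly K} * {poly K} :=
  match n with
  | Posz n' => power_coefs_nat n'
  | Negz n' => let: (a, b) := power_coefs_nat n'.+1 in (- a, b - 'X * a)
  end.

Lemma power_coefs_ind (P : int -> {poly K} -> {poly K} -> Prop) :
  P 0 0 (-1) ->
  (forall (n : nat) a b, P n a b -> P n.+1 ('X * a - b) a) ->
  (forall (n : nat) a b, P n a b -> P (- n%:Z) (- a) (b - 'X * a)) ->
  forall n a b, power_coefs n = (a, b) -> P n a b.
Proof.
move=> P0 PS PN; have pos k a b : power_coefs_nat k = (a, b) -> P k a b.
  elim: k a b => [|k IH] a b /=; first by move=> [<- <-].
  by case: (power_coefs_nat k) IH => a' b' IH [<- <-]; apply: PS; apply: IH.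
case=> k a b; first exact: pos.
rewrite -[power_coefs _]/(let: (a, b) := power_coefs_nat k.+1 in (- a, b - 'X * a)) NegzE.
case: (power_coefs_nat k.+1) (pos k.+1) => a' b' H [<- <-].
by apply: PN; apply: H.
Qed.

(** The left-hand side is the determinant of [a A - b] for [A] of determinant 1
    and trace ['X]. *)
Lemma power_coefs_norm n a b : power_coefs n = (a, b) ->
  a ^+ 2 - 'X * a * b + b ^+ 2 = 1.
Proof.
move: n a b; apply: (@power_coefs_ind (fun n a b => a ^+ 2 - 'X * a * b + b ^+ 2 = 1))
  => [|n a b <-|n a b <-]; ring.
Qed.

(** This is [T_n' = n U_(n-1)] for the Chebyshev polynomials, normalized by
    [T_n (s + 1/s) = s^n + s^-n]. *)
Lemma power_coefs_deriv n a b : power_coefs n = (a, b) ->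
  ('X * a - 2 * b)^`() = n%:~R * a.
Proof.
(* The second formula is the first one for [n - 1], with the pair
   [(b, 'X * b - a)]. *)
move=> E; suff [] : ('X * a - 2 * b)^`() = n%:~R * a /\
  (2 * a - 'X * b)^`() = (n%:~R - 1) * b by [].
move: n a b E; apply: (@power_coefs_ind (fun n a b =>
  ('X * a - 2 * b)^`() = n%:~R * a /\ (2 * a - 'X * b)^`() = (n%:~R - 1) * b)).
- split; first by rewrite !mulr0 sub0r mulrN1 opprK -(rmorph_nat polyC) derivC.
  have -> : 2 * 0 - 'X * -1 = 'X :> {poly K} by ring.
  by rewrite derivX; ring.
- move=> n a b [IH1 IH2]; split.
    have -> : 'X * ('X * a - b) - 2 * a = 'X * ('X * a - 2 * b) - (2 * a - 'X * b) by ring.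
    by rewrite derivB derivM IH1 IH2 derivX intS rmorphD /=; ring.
  have -> : 2 * ('X * a - b) - 'X * a = 'X * a - 2 * b by ring.
  by rewrite IH1 intS rmorphD /=; ring.
- move=> n a b [IH1 IH2]; split.
    have -> : 'X * - a - 2 * (b - 'X * a) = 'X * a - 2 * b by ring.
    by rewrite IH1 mulrNz; ring.
  have -> : 2 * - a - 'X * (b - 'X * a) = 'X * ('X * a - 2 * b) - (2 * a - 'X * b) by ring.
  by rewrite derivB derivM IH1 IH2 derivX mulrNz; ring.
Qed.

Lemma power_coefs_at2 n a b : power_coefs n = (a, b) ->
  a.[2] = n%:~R /\ b.[2] = n%:~R - 1.
Proof.
move: n a b; apply: (@power_coefs_ind (fun n a b => a.[2] = n%:~R /\ b.[2] = n%:~R - 1)).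
- by rewrite !hornerE; split; rewrite ?sub0r.
- move=> n a b [E1 E2]; rewrite !hornerE E1 E2 intS rmorphD /=; split; ring.
- move=> n a b [E1 E2]; rewrite !hornerE E1 E2 mulrNz; split; ring.
Qed.

Lemma power_coefs_atN2 n a b : power_coefs n = (a, b) ->
  exists2 e : K, e ^+ 2 = 1 & a.[-2] = - e * n%:~R /\ b.[-2] = e * (n%:~R - 1).
Proof.
move: n a b; apply: (@power_coefs_ind (fun n a b => exists2 e : K,
  e ^+ 2 = 1 & a.[-2] = - e * n%:~R /\ b.[-2] = e * (n%:~R - 1))).
- by exists 1; rewrite ?expr1n // !hornerE; split; ring.
- move=> n a b [e Ee [E1 E2]]; exists (- e); first by rewrite sqrrN.
  rewrite !hornerE E1 E2 intS rmorphD /=; split; ring.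
- move=> n a b [e Ee [E1 E2]]; exists e => //.
  rewrite !hornerE E1 E2 mulrNz; split; ring.
Qed.

Lemma power_coefs_size n a b : n != 0 -> power_coefs n = (a, b) ->
  [/\ 'X * a - 2 * b \is monic, (1 < size ('X * a - 2 * b)%R)%N &
      (size (a - b)%R <= size ('X * a - 2 * b)%R)%N].
Proof.
have nat_size (k : nat) a' b' : power_coefs_nat k.+1 = (a', b') ->
    [/\ a' \is monic, size a' = k.+1 & (size b' <= k)%N].
  elim: k a' b' => [|k IH] a' b'.
    move=> /= [<- <-]; rewrite mulr0 sub0r opprK size_poly0 monic1 size_poly1; by split.
  rewrite -[power_coefs_nat _]/(let: (a, b) := power_coefs_nat k.+1 in ('X * a - b, a)).
  case E: (power_coefs_nat _) => [a1 b1] [<- <-].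
  have [m1 s1 s2] := IH _ _ E.
  have sX : size ('X * a1) = k.+2 by rewrite mulrC size_mulX ?monic_neq0 // s1.
  have lt : (size (- b1)%R < size ('X * a1)%R)%N by rewrite size_polyN sX ltnW.
  split; [|by rewrite size_polyDl // sX|by rewrite s1].
  by rewrite monicE lead_coefDl // -monicE monicMl // monicX.
have main (k : nat) a' b' : power_coefs_nat k.+1 = (a', b') ->
    [/\ 'X * a' - 2 * b' \is monic, size ('X * a' - 2 * b') = k.+2,
        size a' = k.+1 & (size b' <= k)%N].
  move=> /nat_size[m1 s1 s2].
  have sX : size ('X * a') = k.+2 by rewrite mulrC size_mulX ?monic_neq0 // s1.
  have lt : (size (- (2 * b'))%R < size ('X * a')%R)%N.
    rewrite size_polyN sX -(rmorph_nat polyC) mul_polyC ltnS.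
    by apply: leq_trans (size_scale_leq _ _) (leq_trans s2 _).
  split=> //; last by rewrite size_polyDl // sX.
  by rewrite monicE lead_coefDl // -monicE monicMl // monicX.
case: n => [[//|k] _ /main[m1 s1 sa sb]|k _].
  split; rewrite ?s1 // (leq_trans (size_polyD _ _)) // geq_max sa size_polyN leqnSn.
  by rewrite (leq_trans sb) // leqW.
rewrite /power_coefs; case E : (power_coefs_nat _) => [a' b'] [<- <-].
have [m1 s1 sa sb] := main _ _ _ E.
have -> : 'X * - a' - 2 * (b' - 'X * a') = 'X * a' - 2 * b' by ring.
split; rewrite ?s1 //.
have -> : - a' - (b' - 'X * a') = 'X * a' - (a' + b') by ring.
rewrite (leq_trans (size_polyD _ _)) // geq_max size_polyN mulrC.
rewrite (leq_trans (size_mul_leq _ _)) ?size_polyX ?addn2 ?sa //=.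
by rewrite (leq_trans (size_polyD _ _)) // geq_max sa leqnSn (leq_trans sb) // leqW.
Qed.

End ChebyshevPairs.

(** The equations say that [x y P(v) = z Q(v)] is singular at [(x, y, z)], where
    [P = a - b], [Q = v a - 2 b], [Q' = c a] and [P'] is arbitrary.  With [E] as
    below, either [E = 0], which forces [Q = 0] and [x = y = z = 0], where
    [v = -2] and [Q] does not vanish; or [y = e x] with [e = 1] or [e = -1], and
    then [v = s + 1/s] for [s = e z - 1], so that the equation becomes
    [(s - 1) (b - s a) = 0]; but the norm [a^2 - v a b + b^2] vanishes when
    [b = s a], and when [s = 1], where [v = 2], it is the square of [P], and the
    first partial derivative gives [P = 0]. *)
Lemma geometric_no_critical_zero (K : fieldType) (x y z v a b c P' : K) :
  2 != 0 :> K -> c != 0 ->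
  v = x ^+ 2 + y ^+ 2 + z ^+ 2 - x * y * z - 2 ->
  a ^+ 2 - v * a * b + b ^+ 2 = 1 ->
  let E := x * y * P' - z * (c * a) in
  x * y * (a - b) - z * (v * a - 2 * b) = 0 ->
  y * (a - b) + E * (2 * x - y * z) = 0 ->
  x * (a - b) + E * (2 * y - x * z) = 0 ->
  - (v * a - 2 * b) + E * (2 * z - x * y) = 0 -> False.
Proof.
move=> two0 c0 Ev N E hf hx hy hz.
have cancel (s t : K) : s * t = 0 -> s != 0 -> t = 0.
  by move=> /eqP; rewrite mulf_eq0 => /orP[->//|/eqP].
have N0 : a ^+ 2 - v * a * b + b ^+ 2 <> 0 by rewrite N; apply/eqP/oner_neq0.
have Qm2 : v = -2 -> v * a - 2 * b <> 0.
  move=> Hv Q0; apply: N0; rewrite Hv.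
  have ab : a + b = 0.
    apply: (cancel (-2)); last by rewrite oppr_eq0.
    by rewrite -[RHS]Q0 Hv; ring.
  rewrite (_ : _ + _ = (a + b) ^+ 2); last by ring.
  by rewrite ab expr0n.
have PQ : a - b = 0 -> v * a - 2 * b <> 0.
  move=> /subr0_eq ab; rewrite ab => Q0; apply: N0.
  rewrite ab (_ : _ + _ = - b * (v * b - 2 * b)); last by ring.
  by rewrite Q0 mulr0.
have [E0 | E0] := eqVneq E 0.
  have Q0 : v * a - 2 * b = 0 by apply/eqP; move: hz; rewrite E0 mul0r addr0 => /eqP; rewrite oppr_eq0.
  have P0 : a - b != 0 by apply/eqP=> /PQ.
  have x0 : x = 0 by apply: (cancel (a - b)) => //; rewrite mulrC -[RHS]hy E0; ring.
  have y0 : y = 0 by apply: (cancel (a - b)) => //; rewrite mulrC -[RHS]hx E0; ring.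
  have a0 : a != 0.
    apply/eqP=> a0; have b0 : b = 0.
      by apply: (cancel (-2)); rewrite ?oppr_eq0 // -[RHS]Q0 a0; ring.
    by apply: N0; rewrite a0 b0; ring.
  have z0 : z = 0.
    apply: (cancel (c * a)); last by rewrite mulf_neq0.
    by apply/eqP; rewrite -oppr_eq0 -[X in _ == X]E0 /E x0; apply/eqP; ring.
  by apply: Qm2 Q0; rewrite Ev x0 y0 z0; ring.
have xy2 : (x - y) * (x + y) = 0.
  apply: (cancel (2 * E)); last by rewrite mulf_neq0.
  rewrite (_ : _ * _ = x * (y * (a - b) + E * (2 * x - y * z)) -
    y * (x * (a - b) + E * (2 * y - x * z))); last by ring.
  by rewrite hx hy; ring.
have [e e2 Ey] : exists2 e, e ^+ 2 = 1 & y = e * x.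
  move/eqP: xy2; rewrite mulf_eq0 => /orP[/eqP/subr0_eq<-|/eqP H].
    by exists 1; rewrite ?expr1n ?mul1r.
  exists (-1); first by rewrite sqrrN expr1n.
  by apply/eqP; rewrite mulN1r -addr_eq0 addrC H.
have e0 : e != 0 by rewrite -sqrf_eq0 e2 oner_neq0.
have xz : x ^+ 2 + z ^+ 2 - x * y * z = 0.
  apply: (cancel (2 * E)); last by rewrite mulf_neq0.
  rewrite (_ : _ * _ = x * (y * (a - b) + E * (2 * x - y * z)) +
    z * (- (v * a - 2 * b) + E * (2 * z - x * y)) -
    (x * y * (a - b) - z * (v * a - 2 * b))); last by ring.
  by rewrite hx hz hf; ring.
have Ev' : v = x ^+ 2 - 2.
  by rewrite Ev -[LHS]subr0 -[X in _ - X]xz Ey exprMn e2; ring.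
have x0 : x != 0.
  apply/eqP=> x0; have z0 : z = 0.
    by apply/eqP; rewrite -sqrf_eq0 -[X in _ == X]xz x0; apply/eqP; ring.
  apply: Qm2; first by rewrite Ev' x0; ring.
  by apply/eqP; rewrite -oppr_eq0 -[X in _ == X]hz z0 x0; apply/eqP; ring.
pose s := e * z - 1.
have Ez : z = e * (s + 1) by rewrite /s subrK mulrA -expr2 e2 mul1r.
have Es : x ^+ 2 * s = (s + 1) ^+ 2.
  apply/eqP; rewrite -subr_eq0 -oppr_eq0 -[X in _ == X]xz Ey Ez; apply/eqP.
  rewrite (_ : x * (e * x) * (e * (s + 1)) = e ^+ 2 * (x ^+ 2 * (s + 1))); last by ring.
  by rewrite exprMn e2; ring.
have s10 : s + 1 != 0.
  apply/eqP=> s10; move/eqP: Es; rewrite s10 expr0n mulf_eq0 expf_eq0 (negbTE x0) /=.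
  move=> /eqP s0; move/eqP: s10; rewrite s0 add0r; exact/negP/oner_neq0.
have s0 : s != 0.
  apply: contra_neq s10 => s0; apply/eqP; rewrite -sqrf_eq0 -Es s0 mulr0 //.
have vs : v * s = s ^+ 2 + 1 by rewrite Ev' mulrBl Es; ring.
have main : (s - 1) * (b - s * a) = 0.
  apply: (cancel (e * (s + 1))); last first.
    by rewrite mulf_neq0.
  rewrite -[RHS](mulr0 s) -hf Ey Ez.
  rewrite [RHS](_ : _ = e * ((x ^+ 2 * s) * (a - b) - (s + 1) * (v * s * a - 2 * s * b)));
    last by ring.
  by rewrite Es vs; ring.
have bs : b = s * a -> False.
  move=> bs; apply: N0; rewrite bs.
  rewrite (_ : _ + _ = a ^+ 2 * (1 - v * s + s ^+ 2)); last by ring.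
  by rewrite vs; ring.
move/eqP: main; rewrite mulf_eq0 => /orP[/eqP/subr0_eq s1|/eqP/subr0_eq/bs//].
have v2 : v = 2 by rewrite -[LHS]mulr1 -s1 vs s1; ring.
apply: N0; rewrite v2 (_ : _ + _ = (a - b) ^+ 2); last by ring.
rewrite (cancel (e * x) (a - b)) ?expr0n //; last first.
  by rewrite mulf_neq0.
rewrite -[RHS]hx Ey Ez s1.
rewrite (_ : e * x * (e * (1 + 1)) = e ^+ 2 * (2 * x)); last by ring.
by rewrite e2; ring.
Qed.

(** * The defining polynomials of the character variety *)

Section DefiningPolynomials.
Variable K : fieldType.
Implicit Types (a b : {poly K}) (p : 'rV[K]_3) (g : {mpoly K[3]}).

Definition commutator_trace : {mpoly K[3]} :=
  'X_0 ^+ 2 + 'X_1 ^+ 2 + 'X_2 ^+ 2 - 'X_0 * 'X_1 * 'X_2 - 2%:R%:MP.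

Definition commutator_value p : K :=
  p 0 0 ^+ 2 + p 0 1 ^+ 2 + p 0 2 ^+ 2 - p 0 0 * p 0 1 * p 0 2 - 2.

Definition at_trace a : {mpoly K[3]} :=
  (map_poly (@mpolyC 3 K) a).[commutator_trace].

Fact at_trace_additive : additive at_trace.
Proof. by move=> a b; rewrite /at_trace rmorphB hornerD hornerN. Qed.

Fact at_trace_multiplicative : multiplicative at_trace.
Proof. by split=> [a b|]; rewrite /at_trace ?rmorphM ?rmorph1 ?hornerM ?hornerC. Qed.

HB.instance Definition _ := GRing.isAdditive.Build _ _ at_trace at_trace_additive.
HB.instance Definition _ :=
  GRing.isMultiplicative.Build _ _ at_trace at_trace_multiplicative.

Lemma at_traceX : at_trace 'X = commutator_trace.
Proof. by rewrite /at_trace map_polyX hornerX. Qed.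

Lemma at_traceC (c : K) : at_trace c%:P = c%:MP.
Proof. by rewrite /at_trace map_polyC hornerC. Qed.

Lemma peval_commutator_trace p : peval commutator_trace p = commutator_value p.
Proof.
by rewrite /peval /commutator_trace !mevalB !mevalD !mevalM ?rmorphXn /= !mevalXU mevalC.
Qed.

Lemma peval_at_trace a p : peval (at_trace a) p = a.[commutator_value p].
Proof.
rewrite -peval_commutator_trace; elim/poly_ind: a => [|a c IH].
  by rewrite rmorph0 horner0 /peval meval0.
rewrite rmorphD rmorphM /= at_traceX at_traceC /peval mevalD mevalM mevalC.
by rewrite hornerMXaddC -IH.
Qed.

Lemma mderiv_at_trace i a :
  (at_trace a)^`M(i) = at_trace a^`() * commutator_trace^`M(i).
Proof.
elim/poly_ind: a => [|a c IH]; first by rewrite deriv0 !rmorph0 mderiv0 mul0r.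
rewrite !rmorphD !rmorphM /= at_traceX at_traceC mderivD mderivM mderivC addr0 IH.
by rewrite derivD derivC addr0 derivM derivX mulr1 rmorphD rmorphM /= at_traceX; ring.
Qed.

(** The polynomial [x y S_(n-1) - (x y - z) S_(n-2) - z S_n] at the commutator
    trace, rewritten with [a = S_(n-1)], [b = S_(n-2)] and
    [S_n = 'X * a - b]. *)
Definition geometric_poly a b : {mpoly K[3]} :=
  'X_0 * 'X_1 * at_trace (a - b) - 'X_2 * at_trace ('X * a - 2 * b).

Definition geometric_value a b p : K :=
  let v := commutator_value p in
  p 0 0 * p 0 1 * (a.[v] - b.[v]) - p 0 2 * (v * a.[v] - 2 * b.[v]).

Lemma peval_geometric_poly a b p : peval (geometric_poly a b) p = geometric_value a b p.
Proof.
rewrite /geometric_poly /peval mevalB !mevalM !mevalXU -!/(peval _ p) !peval_at_trace.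
by rewrite !hornerE.
Qed.

Lemma peval_mderiv_trace p :
  [/\ peval commutator_trace^`M(0) p = 2 * p 0 0 - p 0 1 * p 0 2,
      peval commutator_trace^`M(1) p = 2 * p 0 1 - p 0 0 * p 0 2 &
      peval commutator_trace^`M(2) p = 2 * p 0 2 - p 0 0 * p 0 1].
Proof.
rewrite /peval /commutator_trace; split;
by rewrite !expr2 !mderivB !mderivD !mderivM mderivC !mderivXU /=
  !(mevalB, mevalD, mevalM, mevalC, mevalXU); ring.
Qed.

(** The commutator trace as a polynomial in [z]. *)
Definition trace_in_last : {poly {mpoly K[2]}} :=
  'X ^+ 2 + (- ('X_0 * 'X_1)%:P * 'X + ('X_0 ^+ 2 + 'X_1 ^+ 2 - 2%:R%:MP)%:P).

Lemma muniXU :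
  [/\ muni ('X_0 : {mpoly K[3]}) = ('X_0)%:P, muni ('X_1 : {mpoly K[3]}) = ('X_1)%:P &
      muni ('X_2 : {mpoly K[3]}) = 'X].
Proof.
have E0 : 0 = widen_ord (leqnSn 2) 0 :> 'I_3 by apply/val_inj.
have E1 : 1 = widen_ord (leqnSn 2) 1 :> 'I_3 by apply/val_inj.
have E2 : 2 = ord_max :> 'I_3 by apply/val_inj.
by split; [rewrite E0 muniX_widen | rewrite E1 muniX_widen | rewrite E2 muniX_max].
Qed.

Lemma muni_commutator_trace : muni commutator_trace = trace_in_last.
Proof.
have [E0 E1 E2] := muniXU.
rewrite /commutator_trace /trace_in_last !expr2 !(muniB, muniD, muniM) E0 E1 E2 muniC.
rewrite !(polyCB, polyCD, polyCM); ring.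
Qed.

Lemma trace_in_last_quadratic : trace_in_last \is monic /\ size trace_in_last = 3.
Proof.
have lt : (size (- ('X_0 * 'X_1)%:P * 'X + ('X_0 ^+ 2 + 'X_1 ^+ 2 - 2%:R%:MP)%:P : {poly {mpoly K[2]}})%R
    < size ('X ^+ 2 : {poly {mpoly K[2]}})%R)%N.
  by rewrite -polyCN size_MXaddC size_polyXn; case: ifP => // _; rewrite ltnS size_polyC; case: eqP.
split; last by rewrite size_polyDl // size_polyXn.
by rewrite monicE lead_coefDl // lead_coefXn.
Qed.

Lemma muni_at_trace a : muni (at_trace a) = map_poly (@mpolyC 2 K) a \Po trace_in_last.
Proof.
elim/poly_ind: a => [|a c IH]; first by rewrite !rmorph0.
rewrite !rmorphD !rmorphM /= at_traceX at_traceC IH muni_commutator_trace muniC.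
by rewrite map_polyX map_polyC comp_polyX comp_polyC.
Qed.

Lemma size_at_trace a : a != 0 ->
  size (muni (at_trace a)) = ((size a).-1 * 2).+1.
Proof.
move=> a0; have [_ s3] := trace_in_last_quadratic.
have Da : map_poly (@mpolyC 2 K) a \Po trace_in_last != 0.
  by rewrite comp_poly_eq0 ?s3 // map_poly_eq0.
have := size_comp_poly (map_poly (@mpolyC 2 K) a) trace_in_last.
rewrite -muni_at_trace in Da *; rewrite s3 size_map_poly /= => <-.
by rewrite prednK // size_poly_gt0.
Qed.

Lemma lead_at_trace a : lead_coef (muni (at_trace a)) = (lead_coef a)%:MP.
Proof.
have [m3 s3] := trace_in_last_quadratic.
rewrite muni_at_trace lead_coef_comp ?s3 // (monicP m3) expr1n mulr1.
by rewrite lead_coef_map.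
Qed.

Lemma noether_position_at_trace a : (1 < size a)%N -> noether_position (at_trace a).
Proof.
move=> sa; have a0 : a != 0 by rewrite -size_poly_gt0 ltnW.
rewrite /noether_position lead_at_trace size_at_trace //; apply/andP; split.
  by case: (size a) sa => [|[]].
by apply: (rmorph_unit (@mpolyC 2 K)); rewrite unitfE lead_coef_eq0.
Qed.

(** The term with factor [z] has the larger degree in [z], by the bound on the
    degree of [a - b]. *)
Lemma noether_position_geometric a b :
  'X * a - 2 * b \is monic -> (1 < size ('X * a - 2 * b)%R)%N ->
  (size (a - b)%R <= size ('X * a - 2 * b)%R)%N ->
  noether_position (geometric_poly a b).
Proof.
rewrite /geometric_poly; move: (a - b) ('X * a - 2 * b) => P Q mQ sQ le.
have [E0 E1 E2] := muniXU.
have Q0 : Q != 0 by rewrite monic_neq0.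
have MQ0 : muni (at_trace Q) != 0 by rewrite -size_poly_gt0 size_at_trace.
have sXQ : size (- ('X * muni (at_trace Q))) = ((size Q).-1 * 2).+2.
  by rewrite size_polyN mulrC size_mulX // size_at_trace.
have lt : (size (('X_0 * 'X_1)%:P * muni (at_trace P))%R <
    size (- ('X * muni (at_trace Q)))%R)%N.
  rewrite sXQ mul_polyC ltnS; apply: leq_trans (size_scale_leq _ _) _.
  have [-> | P0] := eqVneq P 0; first by rewrite !rmorph0 size_poly0.
  by rewrite size_at_trace // ltnS leq_mul2r /= -!subn1 leq_sub2r.
have Em : muni ('X_0 * 'X_1 * at_trace P - 'X_2 * at_trace Q) =
    - ('X * muni (at_trace Q)) + ('X_0 * 'X_1)%:P * muni (at_trace P).
  by rewrite muniB !muniM E0 E1 E2 polyCM addrC.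
rewrite /noether_position Em size_polyDl // sXQ lead_coefDl // lead_coefN.
rewrite lead_coefM lead_coefX lead_at_trace (monicP mQ) mpolyC1 mulr1 unitrN.
exact: unitr1.
Qed.

End DefiningPolynomials.

Arguments commutator_trace {K}.
Arguments trace_in_last {K}.

(** * Critical points *)

Section CriticalPoints.
Variable K : closedFieldType.
Implicit Types (a b : {poly K}) (p : 'rV[K]_3).

Lemma peval_mderiv_geometric a b p i :
  let v := commutator_value p in
  peval (geometric_poly a b)^`M(i) p =
    ((i == 0)%:R * p 0 1 + (i == 1)%:R * p 0 0) * (a.[v] - b.[v])
    - (i == 2)%:R * (v * a.[v] - 2 * b.[v])
    + (p 0 0 * p 0 1 * (a - b)^`().[v] - p 0 2 * ('X * a - 2 * b)^`().[v])
      * peval commutator_trace^`M(i) p.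
Proof.
move=> v; rewrite /geometric_poly mderivB !mderivM !mderiv_at_trace !mderivXU.
rewrite /peval !(mevalB, mevalD, mevalM, mevalXU, mevalC) -!/(peval _ p) !peval_at_trace.
rewrite -/v.
have -> : ('X * a - 2 * b).[v] = v * a.[v] - 2 * b.[v] by rewrite !hornerE.
have -> : (a - b).[v] = a.[v] - b.[v] by rewrite !hornerE.
ring.
Qed.

Lemma gradient_eq0 (g : {mpoly K[3]}) p : gradient g p = 0 -> forall i, peval g^`M(i) p = 0.
Proof. by move=> /matrixP H i; have := H i 0; rewrite !mxE. Qed.

Lemma geometric_gradient_neq0 (n : int) a b p :
  2 != 0 :> K -> n%:~R != 0 :> K -> power_coefs K n = (a, b) ->
  hypersurface (geometric_poly a b) p -> gradient (geometric_poly a b) p != 0.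
Proof.
move=> two0 n0 E; rewrite /hypersurface /= peval_geometric_poly => f0.
apply/eqP=> /gradient_eq0 grad0.
have [v0 v1 v2] := peval_mderiv_trace p.
have := (grad0 0, grad0 1, grad0 2); rewrite !peval_mderiv_geometric v0 v1 v2 (power_coefs_deriv E).
set v := commutator_value p.
have -> : (n%:~R * a).[v] = n%:~R * a.[v] by rewrite hornerM -(rmorph_int polyC) hornerC.
rewrite /= !(mulr0n, mulr1n) !(mul0r, mul1r, add0r, addr0, subr0) => -[[h0 h1] h2].
have N : a.[v] ^+ 2 - v * a.[v] * b.[v] + b.[v] ^+ 2 = 1.
  by have := congr1 (fun q => q.[v]) (power_coefs_norm E); rewrite !hornerE /= => ->.
exact: (@geometric_no_critical_zero K (p 0 0) (p 0 1) (p 0 2) v a.[v] b.[v] n%:~R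
  (a - b)^`().[v] two0 n0 erefl N f0 h0 h1 h2).
Qed.

(** At a critical point [x^2 = y^2 = z^2] and [x y z = 2 x^2], whence
    [x^6 = 4 x^4]: either [x = y = z = 0], or [x^2 = 4]. *)
Lemma commutator_critical p : 2 != 0 :> K ->
  gradient commutator_trace p = 0 ->
  commutator_value p = -2 \/
  [/\ commutator_value p = 2, p 0 0 ^+ 2 = 4, p 0 1 ^+ 2 = 4 & 2 * p 0 2 = p 0 0 * p 0 1].
Proof.
move=> two0 /gradient_eq0 grad0; have [v0 v1 v2] := peval_mderiv_trace p.
move: (grad0 0) (grad0 1) (grad0 2); rewrite v0 v1 v2 /commutator_value.
move: (p 0 0) (p 0 1) (p 0 2) => x y z h0 h1 h2.
have cancel (s t : K) : s * t = 0 -> s != 0 -> t = 0.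
  by move=> /eqP; rewrite mulf_eq0 => /orP[->//|/eqP].
have xy : x ^+ 2 = y ^+ 2.
  apply/subr0_eq/(cancel 2) => //.
  rewrite (_ : _ * _ = x * (2 * x - y * z) - y * (2 * y - x * z)); last by ring.
  by rewrite h0 h1; ring.
have xz : x ^+ 2 = z ^+ 2.
  apply/subr0_eq/(cancel 2) => //.
  rewrite (_ : _ * _ = x * (2 * x - y * z) - z * (2 * z - x * y)); last by ring.
  by rewrite h0 h2; ring.
have xyz : x * y * z = 2 * x ^+ 2.
  apply/subr0_eq; rewrite (_ : _ - _ = - (x * (2 * x - y * z))); last by ring.
  by rewrite h0; ring.
have : x ^+ 4 * (x ^+ 2 - 4) = 0.
  have -> : x ^+ 4 * (x ^+ 2 - 4) = x ^+ 2 * x ^+ 2 * x ^+ 2 - (2 * x ^+ 2) ^+ 2 by ring.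
  by rewrite -xyz {2}xy {2}xz; ring.
move=> /eqP; rewrite mulf_eq0 expf_eq0 /= => /orP[/eqP x0|/eqP/subr0_eq x4]; [left|right].
  by rewrite -xz -xy xyz x0; ring.
split; first by rewrite -xz -xy xyz x4; ring.
- exact: x4.
- by rewrite -xy.
- by apply/subr0_eq.
Qed.

Lemma central_critical p : 2 != 0 :> K ->
  p 0 0 ^+ 2 = 4 -> p 0 1 ^+ 2 = 4 -> 2 * p 0 2 = p 0 0 * p 0 1 ->
  gradient commutator_trace p = 0.
Proof.
move=> two0 x4 y4 zE; have [v0 v1 v2] := peval_mderiv_trace p.
have h0 : 2 * p 0 0 - p 0 1 * p 0 2 = 0.
  apply: (mulfI two0); rewrite mulr0.
  transitivity (p 0 0 * (4 - p 0 1 ^+ 2) - p 0 1 * (2 * p 0 2 - p 0 0 * p 0 1)); first by ring.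
  by rewrite y4 zE; ring.
have h1 : 2 * p 0 1 - p 0 0 * p 0 2 = 0.
  apply: (mulfI two0); rewrite mulr0.
  transitivity (p 0 1 * (4 - p 0 0 ^+ 2) - p 0 0 * (2 * p 0 2 - p 0 0 * p 0 1)); first by ring.
  by rewrite x4 zE; ring.
have h2 : 2 * p 0 2 - p 0 0 * p 0 1 = 0 by rewrite zE subrr.
apply/colP=> i; rewrite [LHS]mxE [RHS]mxE.
have : [|| i == 0, i == 1 | i == 2] by case: i => [[|[|[|]]]].
by case/or3P => /eqP->; rewrite ?v0 ?v1 ?v2.
Qed.

(** At the point [(0, 2)], a square root [d] vanishes, hence so does the second
    partial derivative of its square; that of the right-hand side does not. *)
Lemma discriminant_not_square (d : {mpoly K[2]}) : 2 != 0 :> K ->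
  d ^+ 2 <> ('X_0 ^+ 2 - 4%:MP) * ('X_1 ^+ 2 - 4%:MP).
Proof.
move=> two0 E; have w01 : (0 == 1 :> 'I_2) = false by [].
have w10 : (1 == 0 :> 'I_2) = false by [].
pose w (i : 'I_2) : K := if i == 0 then 0 else 2.
have := congr1 (meval w) E; rewrite expr2 !(mevalM, mevalB, mevalC, expr2, mevalXU) /w !eqxx w10.
have -> : (2 * 2 - 4 : K) = 0 by ring.
rewrite mulr0 => /eqP; rewrite mulf_eq0 orbb -/w => /eqP dw.
have := congr1 (fun q : {mpoly K[2]} => meval w q^`M(1)) E.
rewrite !(expr2, mderivM, mderivB, mderivC, mderivXU) !(mevalM, mevalB, mevalD, mevalC, mevalXU) dw.
rewrite /w !eqxx w10 /=; move: (_.@[_]) => t H; have : 2 ^+ 4 = 0 :> K.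
  by transitivity (-1 * (t * 0 + 0 * t)); [rewrite H; ring | ring].
by move/eqP; rewrite expf_eq0 (negbTE two0).
Qed.

Lemma prime_mul_unit (R : idomainType) (p u : R) :
  u \is a GRing.unit -> prime_elt p -> prime_elt (p * u).
Proof.
move=> uu [p0 pu pP]; have dv c : divides (p * u) c <-> divides p c.
  split=> [[d ->]|[d ->]]; first by exists (d * u); ring.
  by exists (d * u^-1); rewrite mulrACA mulVr // mulr1.
split.
- by rewrite mulf_neq0 //; apply: contraTneq uu => ->; rewrite unitr0.
- by rewrite unitrM (negbTE pu).
by move=> c d /dv/pP[]; [left|right]; apply/dv.
Qed.

Lemma monic_quadratic_coefs (R : nzRingType) (s t c : R)
    (f := 'X ^+ 2 + (- s%:P * 'X + t%:P) - c%:P) :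
  [/\ f`_0 = t - c, f`_1 = - s & f`_2 = 1].
Proof.
rewrite /f -polyCN !(coefB, coefD, coefMX, coefXn, coefC) /=.
by rewrite !(add0r, addr0, subr0).
Qed.

(** A factorization of the Cayley cubic into two polynomials of degree one in
    [z] would make its discriminant [(x^2 - 4) (y^2 - 4)] a square. *)
Lemma cayley_cubic_prime : 2 != 0 :> K -> prime_elt (at_trace ('X - 2%:P) : {mpoly K[3]}).
Proof.
move=> two0; set g := at_trace _.
have np : noether_position g by apply: noether_position_at_trace; rewrite size_XsubC.
have Eg : muni g = trace_in_last - (2%:MP)%:P.
  by rewrite /g rmorphB muniB /= at_traceX at_traceC muni_commutator_trace muniC.
have sg : size (muni g) = 3.
  by rewrite /g size_at_trace ?size_XsubC // polyXsubC_eq0.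
have [k pk] := mpoly_factorial (noether_position_neq0 np).
have gu : g \isn't a GRing.unit by rewrite -unit_muni poly_unitE sg.
case Eprod: g / pk => [u uu|k' p h pp ph]; first by rewrite Eprod uu in gu.
case: ph Eprod => {k' h} [u uu _|k' q h [_ qu _] _ Eprod].
  exact: prime_mul_unit.
exfalso; have np1 : noether_position p.
  by apply: noether_position_factor np; [case: pp | exists (q * h); rewrite Eprod mulrC].
have /andP[s2 _] : noether_position (q * h).
  by apply: noether_position_factor np; [rewrite unitrM (negbTE qu) | exists p].
have /andP[s1 _] := np1.
have Em : muni g = muni p * muni (q * h) by rewrite Eprod muniM.
move: (muni p) (muni (q * h)) s1 s2 Em => f e s1 s2 Em.
have [sf se] : size f = 2 /\ size e = 2.
  move: sg; rewrite Em size_mul -?size_poly_gt0; try exact: ltnW.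
  by move: (size f) (size e) s1 s2 => i j; lia.
have f2 : f`_2 = 0 by rewrite nth_default ?sf.
have e2 : e`_2 = 0 by rewrite nth_default ?se.
have c i : (f * e)`_i = (trace_in_last - (2%:MP)%:P)`_i by rewrite -Em Eg.
have [q0 q1 q2] := monic_quadratic_coefs ('X_0 * 'X_1)
  ('X_0 ^+ 2 + 'X_1 ^+ 2 - 2%:R%:MP) (2%:MP : {mpoly K[2]}).
have c0 : f`_0 * e`_0 = 'X_0 ^+ 2 + 'X_1 ^+ 2 - 4%:MP.
  have := c 0%N; rewrite coefM big_ord_recl big_ord0 addr0 => -> /=.
  by rewrite q0 !mpolyC_nat; ring.
have c1 : f`_0 * e`_1 + f`_1 * e`_0 = - ('X_0 * 'X_1).
  have := c 1%N; rewrite coefM !big_ord_recl big_ord0 addr0 => -> /=.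
  by rewrite q1.
have c2 : f`_1 * e`_1 = 1.
  have := c 2%N; rewrite coefM !big_ord_recl big_ord0 addr0 /= f2 e2 mulr0 mul0r add0r addr0.
  by move=> ->; rewrite q2.
apply: (@discriminant_not_square (f`_0 * e`_1 - f`_1 * e`_0)) => //.
rewrite (_ : _ ^+ 2 = (f`_0 * e`_1 + f`_1 * e`_0) ^+ 2 - 4 * (f`_0 * e`_0) * (f`_1 * e`_1));
  last by ring.
rewrite c0 c1 c2 (_ : 4%:MP = 4) ?mpolyC_nat //; ring.
Qed.

End CriticalPoints.

(** * Representations in SL_2 *)

Section TwoByTwo.
Variable K : fieldType.
Implicit Types (A B M U : 'M[K]_2).

(** In terms of entries, identities between matrices become polynomial
    identities. *)
Definition mx2 (a b c d : K) : 'M[K]_2 :=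
  \matrix_(i, j) if i == 0 then if j == 0 then a else b else if j == 0 then c else d.

Lemma mx2_eta A : A = mx2 (A 0 0) (A 0 1) (A 1 0) (A 1 1).
Proof.
apply/matrixP=> i j; rewrite !mxE.
by case: i j => [[|[|//]] i2] [[|[|//]] j2] /=; congr (A _ _); apply/val_inj.
Qed.

Lemma mul_mx2 a b c d a' b' c' d' :
  mx2 a b c d * mx2 a' b' c' d' =
  mx2 (a * a' + b * c') (a * b' + b * d') (c * a' + d * c') (c * b' + d * d').
Proof.
apply/matrixP=> i j; rewrite !mxE !big_ord_recl big_ord0 addr0 !mxE /=.
by case: (i == 0); case: (j == 0).
Qed.

Lemma add_mx2 a b c d a' b' c' d' :
  mx2 a b c d + mx2 a' b' c' d' = mx2 (a + a') (b + b') (c + c') (d + d').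
Proof. by apply/matrixP=> i j; rewrite !mxE; case: (i == 0); case: (j == 0). Qed.

Lemma opp_mx2 a b c d : - mx2 a b c d = mx2 (- a) (- b) (- c) (- d).
Proof. by apply/matrixP=> i j; rewrite !mxE; case: (i == 0); case: (j == 0). Qed.

Lemma scale_mx2 k a b c d : k *: mx2 a b c d = mx2 (k * a) (k * b) (k * c) (k * d).
Proof. by apply/matrixP=> i j; rewrite !mxE; case: (i == 0); case: (j == 0). Qed.

Lemma scalar_mx2 k : k%:M = mx2 k 0 0 k.
Proof.
apply/matrixP=> i j; rewrite !mxE.
by case: i j => [[|[|//]] i2] [[|[|//]] j2].
Qed.

Lemma tr_mx2 a b c d : \tr (mx2 a b c d) = a + d.
Proof. by rewrite /mxtrace !big_ord_recl big_ord0 addr0 !mxE. Qed.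

Lemma det_mx2 a b c d : \det (mx2 a b c d) = a * d - b * c.
Proof.
rewrite (expand_det_row _ 0) !big_ord_recl big_ord0 addr0 /cofactor !det_mx11 !mxE /=.
by rewrite expr0 expr1 mul1r mulN1r mulrN.
Qed.

Definition mx2E := (mul_mx2, add_mx2, opp_mx2, scale_mx2, scalar_mx2).

Definition adj2 A : 'M[K]_2 := (\tr A)%:M - A.

Lemma adj_mx2 a b c d : adj2 (mx2 a b c d) = mx2 d (- b) (- c) a.
Proof. by rewrite /adj2 tr_mx2 !mx2E; congr mx2; ring. Qed.

Lemma inv_adj2 A : \det A = 1 -> A^-1 = adj2 A.
Proof.
move=> dA; have E : adj2 A * A = 1.
  rewrite -[1]/(1%:M) -dA (mx2_eta A) adj_mx2 det_mx2 !mx2E; congr mx2; ring.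
have uA : A \is a GRing.unit by rewrite unitmxE dA unitr1.
by rewrite -[A^-1]mul1r -E mulrK.
Qed.

Lemma cayley_hamilton2 A : A * A = \tr A *: A - (\det A)%:M.
Proof. rewrite (mx2_eta A) tr_mx2 det_mx2 !mx2E; congr mx2; ring. Qed.

Lemma trace_adj2 A : \tr (adj2 A) = \tr A.
Proof. by rewrite (mx2_eta A) adj_mx2 !tr_mx2 addrC. Qed.

Lemma det_adj2 A : \det (adj2 A) = \det A.
Proof. by rewrite (mx2_eta A) adj_mx2 !det_mx2; ring. Qed.

Lemma power_coefsE n a b A : power_coefs K n = (a, b) -> \det A = 1 ->
  A ^ n = a.[\tr A] *: A - (b.[\tr A])%:M.
Proof.
move=> E; move: n a b E A; apply: (@power_coefs_ind K (fun n a b => forall A, \det A = 1 ->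
  A ^ n = a.[\tr A] *: A - (b.[\tr A])%:M)).
- by move=> A _; rewrite expr0z !hornerE scale0r sub0r -scalemx1 scaleN1r opprK.
- move=> n a b IH A dA; rewrite exprSz IH // mulrBr -scalerAr cayley_hamilton2 dA.
  rewrite [A * _]mul_mx_scalar !hornerE.
  move: (\tr A) (a.[_]) (b.[_]) => v s t.
  by rewrite (mx2_eta A) !mx2E; congr mx2; ring.
- move=> n a b IH A dA; rewrite -exprz_inv (inv_adj2 dA) IH ?det_adj2 // trace_adj2 !hornerE.
  rewrite /adj2; move: (\tr A) (a.[_]) (b.[_]) => v s t.
  by rewrite (mx2_eta A) !mx2E; congr mx2; ring.
Qed.

Lemma expand_word A M B s t :
  (s *: A - t%:M) * M * (s *: B - t%:M) =
  s ^+ 2 *: (A * M * B) - (s * t) *: (A * M + M * B) + t ^+ 2 *: M.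
Proof.
by rewrite (mx2_eta A) (mx2_eta M) (mx2_eta B) !mx2E; congr mx2; ring.
Qed.

(** [M] and the scalar matrices do not contribute. *)
Lemma commutator_span (M U w : 'M[K]_2) (k k' l l' m m' r s t : K) :
  w = r *: (k *: U + l *: M + m%:M) - s *: (k' *: U + l' *: M + m'%:M) + t *: M ->
  M * w - w * M = (r * k - s * k') *: (M * U - U * M).
Proof.
by move=> ->; rewrite (mx2_eta M) (mx2_eta U) !mx2E; congr mx2; ring.
Qed.

Section Words.
Variables M U : 'M[K]_2.
Local Notation x := (\tr M).
Local Notation y := (\tr U).
Local Notation z := (\tr (M * U)).
Local Notation d := (\det M).
Local Notation e := (\det U).

Lemma trace_commutator_word : \tr (U * M * adj2 U * adj2 M) =
  d * y ^+ 2 + e * x ^+ 2 + z ^+ 2 - x * y * z - 2 * (d * e).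
Proof.
by rewrite (mx2_eta M) (mx2_eta U) !adj_mx2 !mul_mx2 !tr_mx2 !det_mx2; ring.
Qed.

Lemma trace_reversed_commutator_word : \tr (adj2 M * adj2 U * M * U) =
  d * y ^+ 2 + e * x ^+ 2 + z ^+ 2 - x * y * z - 2 * (d * e).
Proof.
by rewrite (mx2_eta M) (mx2_eta U) !adj_mx2 !mul_mx2 !tr_mx2 !det_mx2; ring.
Qed.

(** The next two identities are homogeneous in [M] and in [U]; at determinant 1
    the coefficients of [U] are [x y - 2 z] and [x y - z v]. *)
Lemma conjugates_sum : U * M * adj2 U + adj2 U * M * U =
  (x * y - 2 * z) *: U + (y ^+ 2 - 2 * e) *: M + (y * (z - x * y) + 2 * (e * x))%:M.
Proof.
rewrite (mx2_eta M) (mx2_eta U) !adj_mx2 !mx2E !tr_mx2 !det_mx2; congr mx2; ring.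
Qed.

Lemma conjugates_product : U * M * adj2 U * adj2 M * (adj2 U * M * U) =
  (d * e * (x * y) - z * (d * y ^+ 2 + e * x ^+ 2 + z ^+ 2 - x * y * z - 2 * (d * e))) *: U
  + (e * (e * d - e * x ^+ 2 + x * y * z - z ^+ 2)) *: M
  + (d * e * (y * z) + e ^+ 2 * x ^+ 3 - 2 * (e ^+ 2 * d * x)
     + e * x * z ^+ 2 - e * x ^+ 2 * y * z)%:M.
Proof.
rewrite (mx2_eta M) (mx2_eta U) !adj_mx2 !mx2E !tr_mx2 !det_mx2; congr mx2; ring.
Qed.

(** The word [w] of the relation lies in the span of [1], [M] and [U], so that
    [M w - w M] is a multiple of [M U - U M]. *)
Lemma word_commutator (s t v : K) :
  d = 1 -> e = 1 -> v = x ^+ 2 + y ^+ 2 + z ^+ 2 - x * y * z - 2 ->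
  let w := (s *: (U * M * adj2 U * adj2 M) - t%:M) * M *
           (s *: (adj2 M * adj2 U * M * U) - t%:M) in
  M * w - w * M =
  (s * (x * y * (s - t) - z * (v * s - 2 * t))) *: (M * U - U * M).
Proof.
move=> d1 e1 Ev w.
have MM : adj2 M * M = 1 by rewrite -inv_adj2 // mulVr // unitmxE d1 unitr1.
have MM' : M * adj2 M = 1 by rewrite -inv_adj2 // mulrV // unitmxE d1 unitr1.
have Ew : w = s ^+ 2 *: (U * M * adj2 U * adj2 M * (adj2 U * M * U))
    - (s * t) *: (U * M * adj2 U + adj2 U * M * U) + t ^+ 2 *: M.
  have EA : U * M * adj2 U * adj2 M * M = U * M * adj2 U by rewrite -mulrA MM mulr1.
  have EB : M * (adj2 M * adj2 U * M * U) = adj2 U * M * U by rewrite !mulrA MM' mul1r.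
  by rewrite /w expand_word -mulrA EA EB.
rewrite conjugates_product conjugates_sum d1 e1 in Ew.
by rewrite (commutator_span Ew) Ev; congr (_ *: _); ring.
Qed.

Lemma link_relation_commutator (n : int) a b v :
  power_coefs K n = (a, b) -> d = 1 -> e = 1 ->
  v = x ^+ 2 + y ^+ 2 + z ^+ 2 - x * y * z - 2 ->
  let w := (U * M * U^-1 * M^-1) ^ n * M * (M^-1 * U^-1 * M * U) ^ n in
  M * w - w * M =
  (a.[v] * (x * y * (a.[v] - b.[v]) - z * (v * a.[v] - 2 * b.[v]))) *: (M * U - U * M).
Proof.
move=> E d1 e1 Ev w; rewrite -(word_commutator _ _ d1 e1 Ev).
have detM (A B : 'M[K]_2) : \det (A * B) = \det A * \det B by apply: det_mulmx.
have dA : \det (U * M * adj2 U * adj2 M) = 1 by rewrite !detM !det_adj2 d1 e1 !mulr1.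
have dB : \det (adj2 M * adj2 U * M * U) = 1 by rewrite !detM !det_adj2 d1 e1 !mulr1.
have tA : \tr (U * M * adj2 U * adj2 M) = v.
  by rewrite trace_commutator_word d1 e1 Ev; ring.
have tB : \tr (adj2 M * adj2 U * M * U) = v.
  by rewrite trace_reversed_commutator_word d1 e1 Ev; ring.
have -> : w = (a.[v] *: (U * M * adj2 U * adj2 M) - (b.[v])%:M) * M *
   (a.[v] *: (adj2 M * adj2 U * M * U) - (b.[v])%:M); last by [].
rewrite /w (inv_adj2 d1) (inv_adj2 e1).
by rewrite (power_coefsE E dA) (power_coefsE E dB) tA tB.
Qed.

End Words.
End TwoByTwo.

(** * The components of the character variety *)

Section ClosedFieldPairs.
Variable K : closedFieldType.

Lemma exists_inverse_sum (z : K) : exists w w', w * w' = 1 /\ w + w' = z.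
Proof.
have [w Ew] := @solve_monicpoly K 2 (fun i => if i == 0%N then -1 else z) isT.
have E : w * (z - w) = 1.
  by rewrite mulrBr -expr2 Ew !big_ord_recl big_ord0 /= expr0 expr1; ring.
by exists w, (z - w); split => //; rewrite addrC subrK.
Qed.

(** For matrices of the shape chosen here, [U] has determinant [w w'] and [M U]
    has trace [w + w']. *)
Lemma exists_pair_with_traces (x y z : K) : exists M U : 'M[K]_2,
  [/\ \det M = 1, \det U = 1, \tr M = x, \tr U = y & \tr (M * U) = z].
Proof.
have [w [w' [ww Ez]]] := exists_inverse_sum z.
exists (mx2 x (-1) 1 0), (mx2 0 w (- w') y).
rewrite !mul_mx2 !det_mx2 !tr_mx2; split; first by ring.
- by rewrite -ww; ring.
- by ring.
- by ring.
- by rewrite -Ez; ring.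
Qed.

(** Given [x = s + 1/s] and [y = t + 1/t], the equation is quadratic in [z], with
    the two solutions [s t + 1/(s t)] and [s/t + t/s]. *)
Lemma exists_diagonal_pair (x y z : K) : x ^+ 2 + y ^+ 2 + z ^+ 2 - x * y * z - 2 = 2 ->
  exists s s' t t', [/\ s * s' = 1, t * t' = 1, s + s' = x, t + t' = y &
    s * t + s' * t' = z].
Proof.
move=> E; have [s [s' [ss Ex]]] := exists_inverse_sum x.
have [t [t' [tt Ey]]] := exists_inverse_sum y.
have : (s * t + s' * t' - z) * (s * t' + s' * t - z) = 0.
  transitivity ((s ^+ 2 + s' ^+ 2) * (t * t') + (t ^+ 2 + t' ^+ 2) * (s * s')
    - (s + s') * (t + t') * z + z ^+ 2); first by ring.
  rewrite ss tt Ex Ey.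
  transitivity ((s + s') ^+ 2 - 2 * (s * s') + (t + t') ^+ 2 - 2 * (t * t')
    - x * y * z + z ^+ 2); first by ring.
  by rewrite Ex Ey ss tt -[RHS](subrr 2) -{1}E; ring.
move=> /eqP; rewrite mulf_eq0 => /orP[/eqP/subr0_eq Ez|/eqP/subr0_eq Ez].
  by exists s, s', t, t'.
by exists s, s', t', t; split => //; rewrite // 1?mulrC // addrC.
Qed.

(** At determinant 1, this is [2 - v], which vanishes if [M] and [U] commute or
    have a common eigenvector. *)
Lemma det_commutator_diff (M U : 'M[K]_2) : \det (M * U - U * M) =
  4 * (\det M * \det U) - (\det M * \tr U ^+ 2 + \det U * \tr M ^+ 2 +
     \tr (M * U) ^+ 2 - \tr M * \tr U * \tr (M * U)).
Proof.
by rewrite (mx2_eta M) (mx2_eta U) !mx2E !det_mx2 !tr_mx2; ring.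
Qed.

Lemma gradient_at_trace_XsubC (c : K) p :
  gradient (at_trace ('X - c%:P)) p = gradient commutator_trace p.
Proof. by apply/colP=> i; rewrite !mxE mderiv_at_trace derivXsubC rmorph1 mul1r. Qed.

Lemma hypersurface_XsubC (c : K) p :
  hypersurface (at_trace ('X - c%:P)) p <-> commutator_value p = c.
Proof.
rewrite /hypersurface /= peval_at_trace hornerXsubC.
by split=> [/subr0_eq | ->]; rewrite ?subrr.
Qed.

Lemma irreducible_sub_at_trace (Z : set 'rV[K]_3) (a : {poly K}) :
  zariski_irreducible Z -> a != 0 -> Z `<=` hypersurface (at_trace a) ->
  exists2 c, a.[c] = 0 & Z `<=` hypersurface (at_trace ('X - c%:P)).
Proof.
move=> irrZ a0; have [r Er] := closed_field_poly_normal a.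
have : forall c, c \in r -> a.[c] = 0.
  move=> c cr; apply/eqP; rewrite -[_ == 0]/(root a c) Er rootZ ?lead_coef_eq0 //.
  by rewrite root_prod_XsubC.
rewrite {2}Er -mul_polyC rmorphM /= => Hr.
case/(irreducible_sub_hypersurfaceM irrZ) => [sub | ].
  case: irrZ => [[p /sub]]; rewrite /hypersurface /= peval_at_trace hornerC.
  by move/eqP; rewrite lead_coef_eq0 (negbTE a0).
elim: r {Er} Hr => [|c r IH] Hr.
  case: irrZ => [[p Zp] _]; rewrite big_nil => /(_ p Zp).
  rewrite /hypersurface /= peval_at_trace hornerC => /eqP.
  by rewrite oner_eq0.
rewrite big_cons rmorphM /= => /(irreducible_sub_hypersurfaceM irrZ)[sub|].
  by exists c => //; apply: Hr; rewrite mem_head.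
by apply: IH => c' c'r; apply: Hr; rewrite in_cons c'r orbT.
Qed.

End ClosedFieldPairs.

Section CharacterVariety.
Variables (R : realType) (n : int).
Local Notation C := (R[i]).
Local Notation a := (power_coefs C n).1.
Local Notation b := (power_coefs C n).2.
Implicit Types (M U : 'M[C]_2).

Let coefsE : power_coefs C n = (a, b).
Proof. exact: surjective_pairing. Qed.

Lemma char_pointE M U : [/\ char_point M U 0 0 = \tr M,
  char_point M U 0 1 = \tr U & char_point M U 0 2 = \tr (M * U)].
Proof. by rewrite /char_point !mxE. Qed.

Lemma char_point_eta (p : 'rV[C]_3) M U :
  \tr M = p 0 0 -> \tr U = p 0 1 -> \tr (M * U) = p 0 2 -> p = char_point M U.
Proof.
move=> E0 E1 E2; have [F0 F1 F2] := char_pointE M U; apply/rowP=> i.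
have : [|| i == 0, i == 1 | i == 2] by case: i => [[|[|[|]]]].
by case/or3P => /eqP->; rewrite ?F0 ?F1 ?F2.
Qed.

Lemma omega_commutator M U : \det M = 1 -> \det U = 1 ->
  let p := char_point M U in
  M * omega n M U - omega n M U * M =
    (a.[commutator_value p] * geometric_value a b p) *: (M * U - U * M).
Proof.
move=> dM dU p; have [E0 E1 E2] := char_pointE M U.
rewrite /geometric_value /commutator_value !E0 !E1 !E2.
exact: (link_relation_commutator coefsE dM dU erefl).
Qed.

Lemma det_commutator_diff_value M U : \det M = 1 -> \det U = 1 ->
  \det (M * U - U * M) = 2 - commutator_value (char_point M U).
Proof.
move=> dM dU; have [E0 E1 E2] := char_pointE M U.
rewrite det_commutator_diff dM dU -E0 -E1 -E2 /commutator_value.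
by move: (char_point M U) => p; ring.
Qed.

Lemma representation_char_value M U :
  representation n M U -> commutator_value (char_point M U) = 2 \/
  a.[commutator_value (char_point M U)] * geometric_value a b (char_point M U) = 0.
Proof.
move=> [dM dU rel]; have := omega_commutator dM dU; rewrite rel subrr => /esym/eqP.
rewrite scaler_eq0 => /orP[/eqP|/eqP E]; [by right | left].
have := det_commutator_diff_value dM dU; rewrite E det0.
by move/esym/subr0_eq.
Qed.

Definition cayley_cubic : {mpoly C[3]} := at_trace ('X - 2%:P).

Lemma cayley_cubic_diagonal p : hypersurface cayley_cubic p ->
  exists M U, [/\ representation n M U, reducible_rep M U & p = char_point M U].
Proof.
move/hypersurface_XsubC => /exists_diagonal_pair[s [s' [t [t' [ss tt E0 E1 E2]]]]].
exists (mx2 s 0 0 s'), (mx2 t 0 0 t').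
have dM : \det (mx2 s 0 0 s') = 1 by rewrite det_mx2 mulr0 subr0.
have dU : \det (mx2 t 0 0 t') = 1 by rewrite det_mx2 mulr0 subr0.
split; last by apply: char_point_eta; rewrite ?mul_mx2 tr_mx2 // !(mulr0, mul0r, addr0, add0r).
  split => //; apply/eqP; rewrite -subr_eq0 omega_commutator //; apply/eqP.
  rewrite (_ : _ - _ = 0) ?scaler0 //.
  by rewrite !mul_mx2 opp_mx2 add_mx2 -[0 in RHS](scale0r 1%:M) scalar_mx2 scale_mx2; congr mx2; ring.
exists (delta_mx 0 0); have st r r' : stablemx (delta_mx 0 0 : 'rV[C]_2) (mx2 r 0 0 r').
  apply/sub_rVP; exists r; apply/rowP=> i; rewrite !mxE !big_ord_recl big_ord0 !mxE /=.
  by case: i => [[|[|]]] //= _; ring.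
split => //; apply/eqP=> /matrixP/(_ 0 0); rewrite !mxE eqxx => /eqP.
by rewrite oner_eq0.
Qed.

Lemma reducible_charactersE : @reducible_characters R n = hypersurface cayley_cubic.
Proof.
apply/seteqP; split=> p; last exact: cayley_cubic_diagonal.
move=> [M [U [[dM dU _] [v [v0 /sub_rVP[r vM] /sub_rVP[s vU]]] ->]]].
apply/hypersurface_XsubC.
have D0 : \det (M * U - U * M) = 0.
  apply/eqP/det0P; exists v => //; rewrite mulmxBr !mulmxA vM vU -!scalemxAl vM vU.
  by rewrite !scalerA mulrC subrr.
by have := det_commutator_diff_value dM dU; rewrite D0 => /esym/subr0_eq.
Qed.

(** Conversely, a point with [v = 2] is the character of a diagonal pair, and at a
    zero of the other two factors the relation holds for every pair in [SL_2]
    with the given traces. *)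
Lemma character_varietyE : @character_variety R n =
  hypersurface (cayley_cubic * (at_trace a * geometric_poly a b)).
Proof.
rewrite hypersurfaceM; apply/seteqP; split=> [p [M [U [rep ->]]] | p].
  case: (representation_char_value rep) => H; first by left; apply/hypersurface_XsubC.
  by right; rewrite /hypersurface /= pevalM peval_at_trace peval_geometric_poly.
case=> [/cayley_cubic_diagonal[M [U [rep _ ->]]] | ]; first by exists M, U.
rewrite /hypersurface /= pevalM peval_at_trace peval_geometric_poly => H.
have [M [U [dM dU E0 E1 E2]]] := exists_pair_with_traces (p 0 0) (p 0 1) (p 0 2).
have Ep := char_point_eta E0 E1 E2; exists M, U; split => //; split => //.
by apply/eqP; rewrite -subr_eq0 omega_commutator // -Ep H scale0r.
Qed.

Lemma central_charactersE (p : 'rV[C]_3) : @central_characters R n p <->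
  [/\ p 0 0 ^+ 2 = 4, p 0 1 ^+ 2 = 4 & 2 * p 0 2 = p 0 0 * p 0 1].
Proof.
have trs (c : C) : \tr (c%:M : 'M_2) = 2 * c by rewrite mxtrace_scalar mulr_natl.
have dets (c : C) : \det (c%:M : 'M_2) = c ^+ 2 by rewrite det_scalar.
have mulS (r s : C) : (r%:M : 'M[C]_2) * s%:M = (r * s)%:M by exact/esym/scalar_mxM.
have two0 : 2 != 0 :> C by rewrite pnatr_eq0.
split=> [[M [U [[dM dU _] /is_scalar_mxP[r EM] /is_scalar_mxP[s EU] ->]]] | [E0 E1 E2]].
  have [-> -> ->] := char_pointE M U; rewrite EM EU mulS !trs.
  rewrite EM dets in dM; rewrite EU dets in dU.
  by rewrite !exprMn dM dU; split; ring.
have half (r : C) : 2 * (r / 2) = r by rewrite mulrCA divff // mulr1.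
have half2 (r : C) : r ^+ 2 = 4 -> (r / 2) ^+ 2 = 1.
  move=> E; apply: (mulfI two0); apply: (mulfI two0).
  by transitivity ((2 * (r / 2)) ^+ 2); [ring | rewrite half E; ring].
exists (p 0 0 / 2)%:M, (p 0 1 / 2)%:M; split; rewrite ?scalar_mx_is_scalar //.
  split; rewrite ?dets ?half2 //; apply/eqP; rewrite -subr_eq0 omega_commutator ?dets ?half2 //.
  by rewrite !mulS [X in X%:M - _]mulrC subrr scaler0.
apply: char_point_eta; rewrite ?mulS trs ?half //.
by apply: (mulfI two0); rewrite E2 -[in RHS](half (p 0 0)) -[in RHS](half (p 0 1)); ring.
Qed.

End CharacterVariety.

(** At [2] and [-2], [a] takes the values [n] and, up to sign, [n]. *)
Lemma at_trace_root_neq2 (K : fieldType) n (a b : {poly K}) (c : K) :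
  n%:~R != 0 :> K -> power_coefs K n = (a, b) -> a.[c] = 0 -> c != 2 /\ c != -2.
Proof.
move=> n0 E ac; split; apply/eqP=> Ec.
  by have [E2 _] := power_coefs_at2 E; move: n0; rewrite -E2 -Ec ac eqxx.
have [e e2 [E2 _]] := power_coefs_atN2 E.
move/eqP: ac; rewrite Ec E2 mulNr oppr_eq0 mulf_eq0 (negbTE n0) orbF -sqrf_eq0 e2.
by rewrite oner_eq0.
Qed.

Section Components.
Variables (R : realType) (n : int).
Hypothesis hn : n != 0.
Local Notation C := (R[i]).
Local Notation a := (power_coefs C n).1.
Local Notation b := (power_coefs C n).2.

Let coefsE : power_coefs C n = (a, b).
Proof. exact: surjective_pairing. Qed.

Let two0 : 2 != 0 :> C.
Proof. by rewrite pnatr_eq0. Qed.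

Let n0 : n%:~R != 0 :> C.
Proof. by rewrite intr_eq0. Qed.

Let a_neq0 : a != 0.
Proof.
by apply: contraNneq n0 => a0; have [<- _] := power_coefs_at2 coefsE; rewrite a0 horner0.
Qed.

Lemma prime_cayley : prime_elt (cayley_cubic R).
Proof. exact: cayley_cubic_prime. Qed.

Lemma noether_cayley : noether_position (cayley_cubic R).
Proof. by apply: noether_position_at_trace; rewrite size_XsubC. Qed.

Let noether_geometric : noether_position (geometric_poly a b).
Proof. by have [mQ sQ le] := power_coefs_size hn coefsE; apply: noether_position_geometric. Qed.

Lemma cayley_smooth_atP p : hypersurface (cayley_cubic R) p ->
  smooth_at (hypersurface (cayley_cubic R)) p <-> ~ @central_characters R n p.
Proof.
move=> cp; apply: iff_trans (prime_hypersurface_smooth_at prime_cayley noether_cayley cp) _.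
have -> : gradient (cayley_cubic R) p = gradient commutator_trace p.
  exact: gradient_at_trace_XsubC.
split=> [/eqP grad /central_charactersE[E0 E1 E2] | ncent].
  exact/grad/central_critical.
apply/eqP=> /(commutator_critical two0)[|[_ E0 E1 E2]]; last exact/ncent/central_charactersE.
move/hypersurface_XsubC: cp => -> /eqP; rewrite -subr_eq0 opprK -natrD.
by rewrite pnatr_eq0.
Qed.

Lemma nonreducible_component_smooth (Z : set 'rV[C]_3) :
  irreducible_component (@character_variety R n) Z ->
  Z <> @reducible_characters R n -> smooth_surface Z.
Proof.
rewrite reducible_charactersE character_varietyE => comp nred.
have [_ irrZ ZX maxZ] := comp.
have subX f g (h : {mpoly C[3]}) : hypersurface f `<=` hypersurface (g * f * h).
  by apply: divides_hypersurface; exists (g * h); rewrite mulrAC.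
case: (irreducible_sub_hypersurfaceM irrZ ZX) => [sub | /(irreducible_sub_hypersurfaceM irrZ)[sub|sub]].
- case: nred; apply/esym/maxZ => //; first exact: hypersurface_closed.
    exact: (prime_hypersurface_irreducible prime_cayley noether_cayley).
  by apply: divides_hypersurface; exists (at_trace a * geometric_poly a b); rewrite mulrC.
- have [c ac {}sub] := irreducible_sub_at_trace irrZ a_neq0 sub.
  have [c2 cN2] := at_trace_root_neq2 n0 coefsE ac.
  apply: (component_smooth_surface comp _ _ sub).
  + by apply: noether_position_at_trace; rewrite size_XsubC.
  + have [q Eq] : exists q, a = q * ('X - c%:P) by apply/factor_theorem/eqP.
    apply: divides_hypersurface.
    exists (cayley_cubic R * geometric_poly a b * at_trace q).
    by rewrite {1}Eq rmorphM /=; ring.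
  move=> p /sub/hypersurface_XsubC Ec; rewrite gradient_at_trace_XsubC.
  apply/eqP=> /(commutator_critical two0)[|[+ _ _ _]]; rewrite Ec => /eqP; exact/negP.
- apply: (component_smooth_surface comp noether_geometric _ sub).
    by apply: divides_hypersurface; exists (cayley_cubic R * at_trace a); rewrite mulrA.
  by move=> p /sub; apply: (geometric_gradient_neq0 two0 n0 coefsE).
Qed.

End Components.

(* The surface of reducible characters is x^2 + y^2 + z^2 - xyz = 4, the Cayley
   cubic; it has nodes at the four characters of central representations, so
   "smooth" holds for that component only away from these points. *)
Theorem proposition1p6 (R : realType) (n : int) (hn : n != 0)
    (Z : set 'rV[R[i]]_3)
    (hZ : irreducible_component (@character_variety R n) Z) :
  (Z <> @reducible_characters R n -> smooth_surface Z) /\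
  (Z = @reducible_characters R n ->
     surface Z /\
     forall p, Z p -> (smooth_at Z p <-> ~ @central_characters R n p)).
Proof.
split; first exact: nonreducible_component_smooth.
rewrite reducible_charactersE => ->; split; last exact: cayley_smooth_atP.
exact: (prime_hypersurface_surface (prime_cayley R) (noether_cayley R)).
Qed.
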